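(* Let $p,q$ be integers with $\min(p,q)\ge 2$ and let $\mathcal G=(V,E)$ be the $(p,q)$-path graph, with edges $a_1,\dots,a_p$ on the path of length $p$ and $b_1,\dots,b_q$ on the path of length $q$, numbered from the closest to the nest $N$ to the closest to the food $F$. Let $(W_e(n))_{e\in E,\,n\ge0}$ be the edge-weights of the trace-reinforced ant process on $\mathcal G$. Then the system \[\begin{cases}\alpha^p+\beta^q=1\\ \alpha^p(1-\alpha)=\beta^q(1-\beta)\end{cases}\] has a unique solution $(\alpha,\beta)$ in $(0,1)^2$ and, almost surely, for all $1\le k\le p$ and $1\le \ell\le q$, \[\lim_{n\to+\infty}\frac{W_{a_k}(n)}{n}=\alpha^k\quad\text{ and }\quad \lim_{n\to+\infty}\frac{W_{b_\ell}(n)}{n}=\beta^\ell.\]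
   Context: $(p,q)$-path graph: for integers $p,q\ge1$, the graph consisting of two parallel paths between $N$ and $F$ (sharing only their endpoints $N$ and $F$), one with $p$ edges and one with $q$ edges. Trace-reinforced ant process. Let $\mathcal G=(V,E)$ be a finite undirected graph with two distinct marked nodes $N$ (nest) and $F$ (food). Random weights $\mathbf W(n)=(W_e(n))_{e\in E}$, $n\ge 0$, are defined recursively. At time $0$, $W_e(0)=1$ for all $e\in E$. Given $\mathbf W(n)$ (and independently of the rest of the past), run a random walk on $\mathcal G$ started at $N$ and stopped when it first hits $F$; at each step, from a vertex $u\ne F$, it crosses an edge $e$ incident to $u$ with probability $W_e(n)/\sum_{e'\sim u}W_{e'}(n)$, where the sum is over the edges $e'$ incident to $u$ (the weights being kept fixed equal to $\mathbf W(n)$ during the whole walk). Let $\gamma(n+1)$ be the set of edges crossed at least once by this walk, and set $W_e(n+1)=W_e(n)+\mathbf 1_{e\in\gamma(n+1)}$ for all $e\in E$. *)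

(* Defs.v *)
From HB Require Import structures.
From mathcomp Require Import all_boot all_order all_algebra.
From mathcomp Require Import all_classical all_reals all_analysis.
Import Order.TTheory GRing.Theory Num.Theory.
Import numFieldNormedType.Exports.

Set Implicit Arguments.
Unset Strict Implicit.
Unset Printing Implicit Defensive.

Local Open Scope classical_set_scope.
Local Open Scope ring_scope.

(* Parallel edges are allowed; [ends e] is read as an unordered pair. *)
Record ant_graph := AntGraph {
  vertex : finType;
  edge : finType;
  ends : edge -> vertex * vertex;
  nest : vertex;
  food : vertex;
  nest_neq_food : nest != food
}.

Section Walks.
Variable G : ant_graph.
Implicit Types (u : vertex G) (e : edge G) (s : seq (edge G)).

Definition incident e u : bool := (u == (ends e).1) || (u == (ends e).2).

Definition opposite u e : vertex G :=
  if u == (ends e).1 then (ends e).2 else (ends e).1.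

(* A walk is the sequence of the edges it crosses, in order; together with the
   starting vertex, it determines the vertices visited. *)
Definition walk_end u s : vertex G := foldl opposite u s.

(* [s] is a walk from [u] none of whose vertices, the last one included,
   is the food. *)
Fixpoint running_walk u s : bool :=
  (u != food G) &&
  (if s is e :: s' then incident e u && running_walk (opposite u e) s'
   else true).

(* [s] is a walk from [u] whose last vertex is its first visit to the food. *)
Fixpoint stopped_walk u s : bool :=
  if s is e :: s' then
    [&& u != food G, incident e u & stopped_walk (opposite u e) s']
  else u == food G.

Variable R : realType.

Definition step_prob (w : edge G -> R) u e : R :=
  if incident e u then w e / \sum_(e' | incident e' u) w e' else 0.

(* The weights W(n) produced by the successive walks x 0, x 1, x 2, ...:
   x n is the walk run with the weights W(n), and gamma(n+1) is the set of
   the edges that occur in x n. *)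
Fixpoint ant_weight (x : nat -> seq (edge G)) (n : nat) (e : edge G) : R :=
  if n is m.+1 then ant_weight x m e + (e \in x m)%:R else 1.

(* [X n] is the n-th walk. Conditionally on the first n walks being
   x 0, ..., x n.-1, and on the next one starting with the steps s without
   having reached the food, its following step crosses e with probability
   proportional to the current weights; the conditional probability is written
   in product form. The walk hits the food in finite time only almost surely,
   so [X n] may take arbitrary values on a null set. *)
Definition is_ant_process (d : measure_display) (T : measurableType d)
    (P : probability T R) (X : nat -> T -> seq (edge G)) : Prop :=
  [/\ forall n s, measurable [set t | X n t = s],
      forall n, {ae P, forall t, stopped_walk (nest G) (X n t)} &
      forall n (x : nat -> seq (edge G)) s e,
        running_walk (nest G) s ->
        P [set t | (forall m, (m < n)%N -> X m t = x m) /\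
                   prefix (rcons s e) (X n t)] =
        (P [set t | (forall m, (m < n)%N -> X m t = x m) /\
                    prefix s (X n t)] *
         (step_prob (ant_weight x n) (walk_end (nest G) s) e)%:E)%E].

End Walks.

Section PathGraph.
Variables p q : nat.

(* [inl false] is N, [inl true] is F, and the inner vertices of the two paths
   are numbered from N to F. *)
Definition path_vertex : finType := (bool + ('I_p.-1 + 'I_q.-1))%type.

(* The i-th vertex, from N for i = 0 to F for i = p (resp. i = q). *)
Definition a_vertex (i : nat) : path_vertex :=
  if i is j.+1 then
    if insub j is Some o then inr (inl o) else inl true
  else inl false.

Definition b_vertex (i : nat) : path_vertex :=
  if i is j.+1 then
    if insub j is Some o then inr (inr o) else inl true
  else inl false.

(* [inl k] is the edge a_(k+1) and [inr l] is the edge b_(l+1). *)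
Definition path_edge : finType := ('I_p + 'I_q)%type.

Definition path_ends (e : path_edge) : path_vertex * path_vertex :=
  match e with
  | inl k => (a_vertex k, a_vertex k.+1)
  | inr l => (b_vertex l, b_vertex l.+1)
  end.

Definition path_graph : ant_graph :=
  @AntGraph path_vertex path_edge path_ends (inl false) (inl true) isT.

End PathGraph.

Definition path_system (R : realType) (p q : nat) (alpha beta : R) : Prop :=
  alpha ^+ p + beta ^+ q = 1 /\
  alpha ^+ p * (1 - alpha) = beta ^+ q * (1 - beta).

(* Main.v *)
Require Import Defs.
From HB Require Import structures.
From mathcomp Require Import all_boot all_order all_algebra.
From mathcomp Require Import all_classical all_reals all_analysis.
From mathcomp Require Import ring lra zify.
Import Order.TTheory GRing.Theory Num.Theory.
Import numFieldNormedType.Exports.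

Set Implicit Arguments.
Unset Strict Implicit.
Unset Printing Implicit Defensive.

Local Open Scope classical_set_scope.
Local Open Scope ring_scope.

(* Let pi(n) be the conditional probability, given the past, that the walk run
   with the weights W(n) crosses the edge e. The martingale with increments
   (1_{e crossed} - pi(n)) / W_e(n) has conditional variances at most
   pi(n) / W_e(n)^2, and the sum of 1_{e crossed} / W_e(n)^2 is at most
   sum_j 1 / j^2; so it converges almost surely, and therefore so does
   ln W_e(n) - sum_{m < n} pi(m) / W_e(m). From there on the argument is pathwise.

   If A and B are n times the resistances of {a_1, ..., a_(k-1)} and of the other
   path, and w = W_(a_k)(n) / n, harmonicity gives n pi(n) / W_(a_k)(n) =
   B / (1 + (A + B) w), so ln w drifts upwards or downwards according to the side
   of (B - 1) / (A + B) on which w lies. By induction on k, a lower bound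
   B > 1 / (1 - a) yields w >= a^k eventually, and symmetrically for upper bounds.
   Lower bounds on one path are upper bounds on its resistance, hence upper bounds
   on the other path, and conversely. Starting from B >= q >= 2, these bounds
   improve one another up to the fixed point, which is unique because the system
   says that alpha^p + beta^q = 1 and
   1 + ... + alpha^(p-1) = 1 + ... + beta^(q-1). *)

(** * Sequences with a drift *)

Section Drift.
Variable R : realType.
Implicit Types (u g : nat -> R).

Lemma ln1Dx_le (x : R) : 0 <= x -> ln (1 + x) <= x.
Proof. by move=> x0; apply: le_ln1Dx; lra. Qed.

Lemma ln_le_harmonic_sum n : ln (n.+1%:R : R) <= \sum_(m < n) m.+1%:R^-1.
Proof.
elim: n => [|n IHn]; first by rewrite ln1 big_ord0.
rewrite big_ord_recr /=.
have -> : n.+2%:R = n.+1%:R * (1 + n.+1%:R^-1) :> R.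
  by rewrite mulrDr mulr1 mulfV ?natr1 ?pnatr_eq0.
rewrite lnM ?posrE ?addr_gt0 ?invr_gt0 ?ltr0n //.
by rewrite lerD // ln1Dx_le.
Qed.

(** Lets a drift of at least [delta / m.+1] per step, from any time [N] on, exceed every bound. *)
Lemma harmonic_sum_unbounded (K : R) (N : nat) :
  exists n, K <= \sum_(N <= m < N + n) m.+1%:R^-1.
Proof.
have [n Hn] : exists n, expR (K + \sum_(m < N) m.+1%:R^-1) <= n%:R :> R.
  exists (Num.truncn (expR (K + \sum_(m < N) m.+1%:R^-1))).+1.
  by rewrite ltW// truncnS_gt.
exists n; rewrite -(lerD2r (\sum_(m < N) m.+1%:R^-1)).
rewrite -(big_mkord xpredT (fun m => m.+1%:R^-1)) [leRHS]addrC.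
rewrite -big_cat_nat ?leq_addr //= !big_mkord.
apply: le_trans (ln_le_harmonic_sum _).
rewrite -ler_expR lnK ?posrE ?ltr0n //.
by apply: le_trans Hn _; rewrite ler_nat leqW // leq_addl.
Qed.

(* The steps tend to 0 and push up whenever [u] is below [c]: once
   [u] is above [c], it can only fall below by one step plus the noise. *)
Lemma drift_ge u g (c C delta : R) :
  cvgn (fun n => u n - \sum_(m < n) g m / m.+1%:R) -> 0 < delta ->
  (\forall n \near \oo, u n <= c -> delta <= g n) ->
  (\forall n \near \oo, - C <= g n) ->
  forall eps, 0 < eps -> \forall n \near \oo, c - eps <= u n.
Proof.
move=> /cvg_ex[/= l ul] d0 [N1 _ HN1] [N2 _ HN2] eps e0.
have e3 : 0 < eps / 3 by lra.
move/cvgrPdist_le/(_ _ e3) : ul => [N3 _ HN3].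
pose N4 := (Num.truncn (`|C| / (eps / 3))).+1.
(* [y] is [u] with its convergent noise replaced by the limit [l]: its increments are exactly
   [g n / n.+1], and from [N] on it stays within [eps / 3] of [u]. *)
pose y n := l + \sum_(m < n) g m / m.+1%:R.
have yS n : y n.+1 = y n + g n / n.+1%:R.
  by rewrite /y big_ord_recr /= addrA.
pose N := maxn (maxn N1 N2) (maxn N3 N4).
have uy n : (N <= n)%N -> `|u n - y n| <= eps / 3.
  move=> Nn; have := HN3 n; rewrite /= -normrN opprB /y opprD => H.
  have -> : u n + (- l - \sum_(m < n) g m / m.+1%:R) =
            u n - \sum_(m < n) g m / m.+1%:R - l by ring.
  by apply: H; lia.
have step n : (N <= n)%N -> - (eps / 3) <= g n / n.+1%:R.
  move=> Nn; have Hg := HN2 n ltac:(rewrite /=; lia).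
  have n0 : (0 : R) < n.+1%:R by rewrite ltr0n.
  rewrite ler_pdivlMr // (le_trans _ Hg) // mulNr lerN2.
  rewrite (le_trans (ler_norm _)) // mulrC -ler_pdivrMr //.
  have := truncnS_gt (`|C| / (eps / 3)); rewrite -/N4 => /ltW H4.
  by apply: le_trans H4 _; rewrite ler_nat; lia.
have up n : (N <= n)%N -> y n <= c - eps / 3 -> delta <= g n.
  move=> Nn yc; apply: HN1; first by rewrite /=; lia.
  by have := uy n Nn; rewrite ler_norml => /andP[]; lra.
(* Below [c - eps / 3] the drift pushes up; above it, one step loses at most [eps / 3]. So [y]
   cannot fall back below [c - 2 * (eps / 3)]. *)
have inv n : (N <= n)%N -> c - 2 * (eps / 3) <= y n ->
    c - 2 * (eps / 3) <= y n.+1.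
  move=> Nn Hy; rewrite yS.
  have [yc|yc] := leP (y n) (c - eps / 3).
    apply: (le_trans Hy); rewrite lerDl.
    by rewrite divr_ge0 // (le_trans (ltW d0)) // up.
  by move: (step n Nn); set z := g n / _ => ?; lra.
(* If [y] stayed below this barrier forever, its drift would remain at least [delta], and the
   harmonic series would push it past. *)
have [n0 Nn0 Hn0] : exists2 n0, (N <= n0)%N & c - 2 * (eps / 3) <= y n0.
  apply: contrapT => Hno.
  have low n : (N <= n)%N -> y n < c - 2 * (eps / 3).
    by move=> Nn; rewrite ltNge; apply/negP => Hy; apply: Hno; exists n.
  have [n Hn] := harmonic_sum_unbounded ((c - y N) / delta) N.
  have Hgrow k : y N + delta * \sum_(N <= m < N + k) m.+1%:R^-1 <= y (N + k)%N.
    elim: k => [|k IHk]; first by rewrite addn0 big_geq // mulr0 addr0.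
    rewrite addnS big_nat_recr ?leq_addr //= yS mulrDr addrA lerD //.
    rewrite ler_wpM2r ?invr_ge0 ?ler0n // up ?leq_addr //.
    by have := low (N + k)%N (leq_addr _ _); lra.
  have := Hgrow n; have := low (N + n)%N (leq_addr _ _).
  by rewrite ler_pdivrMr // mulrC in Hn; lra.
exists n0 => // n /= nn0.
have : c - 2 * (eps / 3) <= y n.
  rewrite -(subnKC nn0); elim: (n - n0)%N => [|k IHk]; first by rewrite addn0.
  by rewrite addnS inv // (leq_trans Nn0) // leq_addr.
have := uy n (leq_trans Nn0 nn0); rewrite ler_norml => /andP[]; lra.
Qed.

Lemma drift_le u g (c C delta : R) :
  cvgn (fun n => u n - \sum_(m < n) g m / m.+1%:R) -> 0 < delta ->
  (\forall n \near \oo, c <= u n -> g n <= - delta) ->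
  (\forall n \near \oo, g n <= C) ->
  forall eps, 0 < eps -> \forall n \near \oo, u n <= c + eps.
Proof.
move=> ug d0 Hc HC eps e0.
have : \forall n \near \oo, - c - eps <= - u n.
  apply: (@drift_ge (fun n => - u n) (fun n => - g n) _ C delta) => //.
  - have -> : (fun n => - u n - \sum_(m < n) - g m / m.+1%:R) =
              (fun n => - (u n - \sum_(m < n) g m / m.+1%:R)).
      apply/funext => n; rewrite opprD; congr (_ + _).
      by rewrite opprK -sumrN; apply: eq_bigr => i _; rewrite mulNr opprK.
    exact: is_cvgN.
  - by apply: filterS Hc => n H; rewrite lerN2 => /H; lra.
  - by apply: filterS HC => n; lra.
by apply: filterS => n; lra.
Qed.

End Drift.

(** * One path against a given resistance *)

Definition geom (R : realType) k (a : R) : R := \sum_(i < k) a ^+ i.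

(** This is [n] times the resistance of a path whose edges have weights [n * a], ...,
    [n * a ^+ k]. *)
Definition invgeom (R : realType) k (a : R) : R := \sum_(i < k) a ^- i.+1.

(* [w k n] stands for W_(k+1)(n) / (n + 1) along one of the two paths and [B n]
   for (n + 1) times the resistance of the other path. *)
Definition resistance (R : realType) (w : nat -> nat -> R) k n : R :=
  \sum_(i < k) (w i n)^-1.

(** With [A = resistance w k n], the edge is crossed with probability [B / (A + 1 / w + B)]. Divided
    by [w], this is, up to the factor [1 / n.+1], the growth rate of the logarithm of its weight;
    the [- 1] removes that of [ln n]. *)
Definition drift (R : realType) (w : nat -> nat -> R) (B : nat -> R) k n : R :=
  B n / (1 + (resistance w k n + B n) * w k n) - 1.

(** What probability theory supplies, almost surely, to the pathwise argument. *)
Definition driven (R : realType) p (w : nat -> nat -> R) (B : nat -> R) :=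
  forall k, (k < p)%N ->
    cvgn (fun n => ln (w k n) - \sum_(m < n) drift w B k m / m.+1%:R).

Section OnePath.
Variable R : realType.
Implicit Types (a b : R) (w : nat -> nat -> R) (B : nat -> R).

Lemma invgeomE k a : a != 0 ->
  (1 - a) * (1 + invgeom k a * a ^+ k.+1) = 1 - a ^+ k.+1.
Proof.
move=> a0; elim: k => [|k IHk].
  by rewrite /invgeom big_ord0 mul0r addr0 mulr1 expr1.
rewrite /invgeom big_ord_recr /= -/(invgeom k a) [a ^+ k.+2]exprS.
set x := a ^+ k.+1 in IHk *.
have -> : (1 - a) * (1 + (invgeom k a + x^-1) * (a * x)) =
    (1 - a) + a * ((1 - a) * (1 + invgeom k a * x)).
  by field; rewrite expf_neq0.
by rewrite IHk; ring.
Qed.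

Lemma resistance_ge0 w k n : (forall k n, 0 < w k n) -> 0 <= resistance w k n.
Proof. by move=> w0; apply: sumr_ge0 => i _; rewrite invr_ge0 ltW. Qed.

Lemma near_resistance_le p w a : 0 < a ->
  (\forall n \near \oo, forall k, (k < p)%N -> a ^+ k.+1 <= w k n) ->
  \forall n \near \oo, resistance w p n <= invgeom p a.
Proof.
move=> a0; apply: filterS => n H; apply: ler_sum => i _.
have ai : 0 < a ^+ i.+1 by rewrite exprn_gt0.
by rewrite lef_pV2 ?posrE // ?H // (lt_le_trans ai) // H.
Qed.

Lemma near_resistance_ge p w a : 0 < a -> (forall k n, 0 < w k n) ->
  (\forall n \near \oo, forall k, (k < p)%N -> w k n <= a ^+ k.+1) ->
  \forall n \near \oo, invgeom p a <= resistance w p n.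
Proof.
move=> a0 w0; apply: filterS => n H; apply: ler_sum => i _.
have ai : 0 < a ^+ i.+1 by rewrite exprn_gt0.
by rewrite lef_pV2 ?posrE // H.
Qed.

(** Induction over finitely many edges: each one may use the bounds already valid on the edges
    before it. *)
Lemma near_below (P : nat -> nat -> Prop) p :
  (forall k, (k < p)%N ->
    (\forall n \near \oo, forall i, (i < k)%N -> P i n) ->
    \forall n \near \oo, P k n) ->
  \forall n \near \oo, forall k, (k < p)%N -> P k n.
Proof.
move=> HP; elim: p HP => [_|p IHp HP]; first by near=> n => k.
have H1 := IHp (fun k kp => HP k (ltnW kp)).
have H2 := HP p (ltnSn p) H1.
apply: filterS2 H1 H2 => n Hn1 Hn2 k; rewrite ltnS leq_eqVlt => /orP[/eqP->//|].
exact: Hn1.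
Unshelve. all: by end_near. Qed.

(** The bounds on the previous edges give [A <= As], and then the drift is positive as long as [w k]
    stays below a level [th] slightly above [a ^+ k.+1]. *)
Lemma driven_ge p w B a Bs : (forall k n, 0 < w k n) -> (forall n, 0 < B n) ->
  driven p w B -> 0 < a < 1 -> 1 < Bs * (1 - a) ->
  (\forall n \near \oo, Bs <= B n) ->
  \forall n \near \oo, forall k, (k < p)%N -> a ^+ k.+1 <= w k n.
Proof.
move=> w0 B0 dwB /andP[a0 a1] Ba HB; apply: near_below => k kp Hk.
have HA := near_resistance_le a0 Hk.
set As := invgeom k a in HA.
set t := a ^+ k.+1.
have t0 : 0 < t by rewrite exprn_gt0.
have t1 : t < 1 by rewrite exprn_ilt1 // ltW.
have tE : (1 - a) * (1 + As * t) = 1 - t by rewrite invgeomE ?gt_eqF.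
have As0 : 0 <= As by apply: sumr_ge0 => i _; rewrite invr_ge0 exprn_ge0 // ltW.
have Bs0 : 1 < Bs by nra.
have AB0 : 0 < As + Bs by lra.
(* After multiplication by [1 - a], [tE] reduces this to [1 - t < Bs * (1 - a) * (1 - t)]. *)
have gap : t * (As + Bs) < Bs - 1.
  rewrite -(ltr_pM2l (_ : 0 < 1 - a)) ?subr_gt0 //.
  have -> : (1 - a) * (t * (As + Bs)) =
            (1 - a) * (1 + As * t) - (1 - a) + Bs * (1 - a) * t by ring.
  have -> : (1 - a) * (Bs - 1) = Bs * (1 - a) - (1 - a) by ring.
  by rewrite tE; nra.
(* [(Bs - 1) / (As + Bs)] is the level where the drift vanishes for [A = As] and [B = Bs]. The
   midpoint [th] leaves room on both sides, for [dl] and for the final [eps]. *)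
pose th := (t + (Bs - 1) / (As + Bs)) / 2.
have thE : th * (As + Bs) = (t * (As + Bs) + (Bs - 1)) / 2.
  by rewrite /th; field; rewrite gt_eqF.
have tth : t < th by rewrite -(ltr_pM2r AB0) thE; lra.
have th0 : 0 < th by lra.
have den0 : 0 < 1 + (As + Bs) * th by rewrite mulrC thE; nra.
pose dl := Bs / (1 + (As + Bs) * th) - 1.
have dl0 : 0 < dl.
  by rewrite subr_gt0 ltr_pdivlMr // mul1r (mulrC (As + Bs)) thE; lra.
have e0 : 0 < ln th - ln t by rewrite subr_gt0 ltr_ln ?posrE.
have := @drift_ge R (fun n => ln (w k n)) (drift w B k) (ln th) 1 dl
  (dwB k kp) dl0 _ _ _ e0.
have Hdl : \forall n \near \oo, ln (w k n) <= ln th -> dl <= drift w B k n.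
  apply: filterS2 HA HB => n Hn1 Hn2; rewrite ler_ln ?posrE // => Hw.
  rewrite lerD2r; set A := resistance w k n in Hn1 *.
  have A0 : 0 <= A by apply: resistance_ge0.
  have wk := w0 k n; have Bn := B0 n.
  (* [B / (1 + (A + B) * w)] decreases in [A] and [w] and increases in [B]; after
     cross-multiplication two pairs of terms are compared separately. *)
  rewrite ler_pdivrMr // mulrAC ler_pdivlMr; last by nra.
  have -> : B n * (1 + (As + Bs) * th) = B n * (1 + As * th) + B n * Bs * th.
    by ring.
  have -> : Bs * (1 + (A + B n) * w k n) =
    Bs * (1 + A * w k n) + B n * Bs * w k n by ring.
  apply: lerD.
    apply: ler_pM => //; [lra|nra|]; rewrite lerD2l.
    by apply: ler_pM => //; apply: ltW.
  by rewrite ler_wpM2l // mulr_ge0 // ltW //; lra.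
have Hb : \forall n \near \oo, - 1 <= drift w B k n.
  near=> n; rewrite lerDr divr_ge0 ?(ltW (B0 n)) //.
  have A0 : 0 <= resistance w k n by apply: resistance_ge0.
  have wk := w0 k n; have Bn := B0 n; nra.
move=> /(_ Hdl Hb); apply: filterS => n.
by rewrite opprB addrC subrK ler_ln ?posrE.
Unshelve. all: by end_near. Qed.

(** Mirror image of [driven_ge]: upper bounds on the previous edges give [As <= A]. *)
Lemma driven_le p w B b Bs : (forall k n, 0 < w k n) -> (forall n, 0 < B n) ->
  driven p w B -> 0 < b < 1 -> Bs * (1 - b) < 1 -> 0 < Bs ->
  (\forall n \near \oo, B n <= Bs) ->
  \forall n \near \oo, forall k, (k < p)%N -> w k n <= b ^+ k.+1.
Proof.
move=> w0 B0 dwB /andP[a0 a1] Ba Bs0 HB; apply: near_below => k kp Hk.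
have HA := near_resistance_ge a0 w0 Hk.
set As := invgeom k b in HA.
set t := b ^+ k.+1.
have t0 : 0 < t by rewrite exprn_gt0.
have t1 : t < 1 by rewrite exprn_ilt1 // ltW.
have tE : (1 - b) * (1 + As * t) = 1 - t by rewrite invgeomE ?gt_eqF.
have As0 : 0 <= As by apply: sumr_ge0 => i _; rewrite invr_ge0 exprn_ge0 // ltW.
have AB0 : 0 < As + Bs by lra.
have gap : Bs - 1 < t * (As + Bs).
  rewrite -(ltr_pM2l (_ : 0 < 1 - b)) ?subr_gt0 //.
  have -> : (1 - b) * (t * (As + Bs)) =
            (1 - b) * (1 + As * t) - (1 - b) + Bs * (1 - b) * t by ring.
  have -> : (1 - b) * (Bs - 1) = Bs * (1 - b) - (1 - b) by ring.
  by rewrite tE; nra.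
(* [Bs - 1] may be negative; truncating it at 0 keeps [th] positive, so that [ln th] is
   meaningful. *)
pose m := Num.max 0 (Bs - 1).
have m0 : 0 <= m by rewrite le_max lexx.
have mB : Bs - 1 <= m by rewrite le_max lexx orbT.
have mt : m < t * (As + Bs) by rewrite gt_max gap mulr_gt0.
pose th := (t + m / (As + Bs)) / 2.
have thE : th * (As + Bs) = (t * (As + Bs) + m) / 2.
  by rewrite /th; field; rewrite gt_eqF.
have tth : th < t by rewrite -(ltr_pM2r AB0) thE; lra.
have th0 : 0 < th by rewrite -(ltr_pM2r AB0) thE mul0r; nra.
have den0 : 0 < 1 + (As + Bs) * th by rewrite mulrC thE; nra.
pose dl := 1 - Bs / (1 + (As + Bs) * th).
have dl0 : 0 < dl.
  by rewrite subr_gt0 ltr_pdivrMr // mul1r (mulrC (As + Bs)) thE; lra.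
have e0 : 0 < ln t - ln th by rewrite subr_gt0 ltr_ln ?posrE.
have := @drift_le R (fun n => ln (w k n)) (drift w B k) (ln th) Bs dl
  (dwB k kp) dl0 _ _ _ e0.
have Hdl : \forall n \near \oo, ln th <= ln (w k n) -> drift w B k n <= - dl.
  apply: filterS2 HA HB => n Hn1 Hn2; rewrite ler_ln ?posrE // => Hw.
  rewrite opprB lerD2r; set A := resistance w k n in Hn1 *.
  have A0 : 0 <= A by apply: resistance_ge0.
  have wk := w0 k n; have Bn := B0 n.
  rewrite ler_pdivlMr // mulrAC ler_pdivrMr; last by nra.
  have -> : B n * (1 + (As + Bs) * th) = B n * (1 + As * th) + B n * Bs * th.
    by ring.
  have -> : Bs * (1 + (A + B n) * w k n) =
    Bs * (1 + A * w k n) + B n * Bs * w k n by ring.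
  apply: lerD.
    apply: ler_pM => //; [exact: ltW|nra|]; rewrite lerD2l.
    by apply: ler_pM => //; apply: ltW.
  by rewrite ler_wpM2l // mulr_ge0 // ltW //; lra.
have Hb : \forall n \near \oo, drift w B k n <= Bs.
  apply: filterS HB => n HBn.
  have A0 : 0 <= resistance w k n by apply: resistance_ge0.
  have wk := w0 k n; have Bn := B0 n.
  have x0 : 0 <= (resistance w k n + B n) * w k n.
    by rewrite mulr_ge0 ?addr_ge0 // ltW.
  by rewrite lerBlDr ler_pdivrMr ?(le_trans HBn) //; nra.
move=> /(_ Hdl Hb); apply: filterS => n.
by rewrite addrC subrK ler_ln ?posrE.
Qed.

End OnePath.

(** * The algebraic system *)

Section System.
Variable R : realType.
Implicit Types (a b x y alpha beta : R).

Lemma geomE k a : (1 - a) * geom k a = 1 - a ^+ k.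
Proof. by rewrite -[RHS]opprB subrX1 -mulNr opprB. Qed.

Lemma geom_gt0 k a : (0 < k)%N -> 0 <= a -> 0 < geom k a.
Proof.
case: k => // k _ a0; rewrite /geom big_ord_recl expr0 ltr_pwDl //.
by apply: sumr_ge0 => i _; rewrite exprn_ge0.
Qed.

Lemma ltr_geom k a b : (2 <= k)%N -> 0 <= a -> a < b -> geom k a < geom k b.
Proof.
case: k => [//|[//|k]] _ a0 ab; rewrite /geom !big_ord_recl !expr0 !expr1.
rewrite ltrD2l ltr_leD //; apply: ler_sum => i _.
by rewrite lerXn2r ?nnegrE ?(le_trans a0 (ltW ab)) // ltW.
Qed.

Lemma invgeom_geom k a : 0 < a < 1 -> invgeom k a * a ^+ k = geom k a.
Proof.
move=> /andP[a0 a1]; have a0' : a != 0 by rewrite gt_eqF.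
apply: (@mulfI _ ((1 - a) * a)); first by rewrite mulf_neq0 // subr_eq0 gt_eqF.
rewrite [RHS]mulrAC geomE; have := @invgeomE R k a a0'; rewrite exprS => H.
have -> : (1 - a) * a * (invgeom k a * a ^+ k) =
    (1 - a) * (1 + invgeom k a * (a * a ^+ k)) - (1 - a) by ring.
by rewrite H; ring.
Qed.

Lemma invgeom_gt0 k a : (0 < k)%N -> 0 < a -> 0 < invgeom k a.
Proof.
case: k => // k _ a0; rewrite /invgeom big_ord_recl ltr_pwDl ?invr_gt0 ?exprn_gt0 //.
by apply: sumr_ge0 => i _; rewrite invr_ge0 exprn_ge0 // ltW.
Qed.

(** By the first equation [1 - alpha ^+ p = beta ^+ q] and [1 - beta ^+ q = alpha ^+ p], so the
    second one equates the two sums, each multiplied by [(1 - alpha) * (1 - beta)]. *)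
Lemma path_system_geom p q alpha beta : 0 < alpha < 1 -> 0 < beta < 1 ->
  path_system p q alpha beta -> geom p alpha = geom q beta.
Proof.
move=> /andP[a0 a1] /andP[b0 b1] [H1 H2].
have Ha := geomE p alpha; have Hb := geomE q beta.
apply: (@mulfI _ ((1 - alpha) * (1 - beta))).
  by rewrite mulf_neq0 // subr_eq0 gt_eqF.
rewrite mulrAC Ha -mulrA Hb.
have -> : 1 - alpha ^+ p = beta ^+ q by lra.
have -> : 1 - beta ^+ q = alpha ^+ p by lra.
by rewrite -H2 mulrC.
Qed.

(** At the solution, the resistance of the first path sits exactly on the threshold [1 / (1 - beta)]
    that separates [driven_ge] from [driven_le]. *)
Lemma path_system_invgeom p q alpha beta : 0 < alpha < 1 -> 0 < beta < 1 ->
  path_system p q alpha beta -> invgeom p alpha * (1 - beta) = 1.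
Proof.
move=> aI bI sys; have gE := path_system_geom aI bI sys; case: sys => H1 _.
have /andP[a0 _] := aI; have ap0 : alpha ^+ p != 0 by rewrite expf_neq0 ?gt_eqF.
apply: (mulIf ap0); rewrite mulrAC invgeom_geom // gE mulrC geomE mul1r; lra.
Qed.

(** The first equation makes [beta] decrease when [alpha] increases, whereas equality of the
    geometric sums makes them increase together. *)
Lemma path_system_unique p q alpha beta alpha' beta' :
  (2 <= p)%N -> (2 <= q)%N ->
  0 < alpha < 1 -> 0 < beta < 1 -> path_system p q alpha beta ->
  0 < alpha' < 1 -> 0 < beta' < 1 -> path_system p q alpha' beta' ->
  alpha = alpha' /\ beta = beta'.
Proof.
move=> p2 q2.
wlog aa' : alpha beta alpha' beta' / alpha <= alpha'.
  move=> H; have [le|/ltW le] := leP alpha alpha'; first exact: H.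
  by move=> h1 h2 h3 h4 h5 h6; have [-> ->] := H _ _ _ _ le h4 h5 h6 h1 h2 h3.
move=> aI bI sys aI' bI' sys'.
have gE := path_system_geom aI bI sys.
have gE' := path_system_geom aI' bI' sys'.
case: sys sys' => [H _] [H' _].
have [/andP[a0 _] /andP[b0 _]] := (aI, bI).
have [/andP[a0' _] /andP[b0' _]] := (aI', bI').
have p0 : (0 < p)%N by lia.
have q0 : (0 < q)%N by lia.
have bb' : beta' <= beta.
  rewrite -(ler_pXn2r q0) ?nnegrE ?(ltW b0) ?(ltW b0') //.
  have : alpha ^+ p <= alpha' ^+ p by rewrite ler_pXn2r // nnegrE ltW.
  lra.
have gb : geom q beta' <= geom q beta.
  by apply: ler_sum => i _; rewrite lerXn2r // nnegrE ltW.
have ea : alpha = alpha'.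
  apply/eqP; rewrite eq_le aa' leNgt; apply/negP => lt.
  by have := ltr_geom p2 (ltW a0) lt; lra.
split=> //; apply/eqP; rewrite eq_le bb' andbT leNgt; apply/negP => lt.
by have := ltr_geom q2 (ltW b0') lt; rewrite -gE -gE' ea ltxx.
Qed.

Lemma root_exists q y : (0 < q)%N -> 0 < y < 1 ->
  exists2 b, 0 < b < 1 & b ^+ q = y.
Proof.
move=> q0 /andP[y0 y1].
have [||b /itvP Hb bE] := @IVT R (fun x => x ^+ q) 0 1 y ler01.
- by apply: continuous_subspaceT => x; apply: exprn_continuous.
- rewrite expr1n expr0n gtn_eqF //= min_l ?max_r ?ler01 //.
  by apply/andP; split; apply: ltW.
exists b => //; rewrite !lt_neqAle !Hb !andbT; apply/andP; split.
  by apply: contraTneq y0 => b0; rewrite -bE -b0 expr0n gtn_eqF // ltxx.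
by apply: contraTneq y1 => b1; rewrite -bE b1 expr1n ltxx.
Qed.

(** Take [b] with [a ^+ p + b ^+ q = 1]. Then [b > beta], hence [geom p a < geom q b], and both
    inequalities restate this. By the first, the lower bound [a] on one path yields the upper bound
    [b] on the other; by the second, [b] yields in return a bound better than [a]. *)
Lemma path_system_gap p q alpha beta a : (2 <= p)%N -> (2 <= q)%N ->
  0 < alpha < 1 -> 0 < beta < 1 -> path_system p q alpha beta -> 0 < a < alpha ->
  exists b, [/\ 0 < b < 1, invgeom p a * (1 - b) < 1 &
                1 < invgeom q b * (1 - a)].
Proof.
move=> p2 q2 aI bI sys /andP[a0 aalpha].
have gE := path_system_geom aI bI sys; case: sys => H _.
have [/andP[a0' a1'] /andP[b0' b1']] := (aI, bI).
have p0 : (0 < p)%N by lia.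
have q0 : (0 < q)%N by lia.
have a1 : a < 1 by lra.
have ap0 : 0 < a ^+ p by rewrite exprn_gt0.
have ap1 : a ^+ p < 1 by rewrite exprn_ilt1 ?gtn_eqF // ltW.
have lta : a ^+ p < alpha ^+ p by rewrite ltr_pXn2r ?nnegrE ?ltW.
have [b /andP[b0 b1] bE] : exists2 b, 0 < b < 1 & b ^+ q = 1 - a ^+ p.
  by apply: root_exists => //; lra.
have bb : beta < b by rewrite -(ltr_pXn2r q0) ?nnegrE ?ltW // bE; lra.
have gab : geom p a < geom q b.
  apply: (@lt_trans _ _ (geom p alpha)); first by rewrite ltr_geom // ltW.
  by rewrite gE ltr_geom // ltW.
have ga := geomE p a; have gb := geomE q b.
exists b; split; first by rewrite b0 b1.
  rewrite -(ltr_pM2r ap0) mulrAC invgeom_geom ?a0 // mul1r.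
  have -> : a ^+ p = (1 - b) * geom q b by rewrite gb bE; ring.
  by rewrite mulrC ltr_pM2l // subr_gt0.
have bq0 : 0 < b ^+ q by rewrite exprn_gt0.
rewrite -(ltr_pM2r bq0) mulrAC invgeom_geom ?b0 // mul1r bE -ga.
by rewrite mulrC ltr_pM2r // subr_gt0.
Qed.

Lemma continuous_sum_ord k (f : nat -> R -> R) x :
  (forall i, {for x, continuous (f i)}) ->
  {for x, continuous (fun a => \sum_(i < k) f i a)}.
Proof.
move=> fC; elim: k => [|k IHk].
  rewrite (_ : (fun _ => _) = cst 0); last by apply/funext => a; rewrite big_ord0.
  exact: cvg_cst.
rewrite (_ : (fun _ => _) = fun a => \sum_(i < k) f i a + f k a).
  exact: continuousD.
by apply/funext => a; rewrite big_ord_recr.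
Qed.

Lemma invgeom_left_continuous k x y : 0 < x -> invgeom k x < y ->
  exists2 a0, 0 < a0 < x & forall a, a0 < a -> a <= x -> invgeom k a < y.
Proof.
move=> x0 xy.
have cts : (@invgeom R k) @ x --> invgeom k x.
  apply: (@continuous_sum_ord k (fun i a => a ^- i.+1)) => i.
  apply: continuousV; last exact: exprn_continuous.
  by rewrite expf_neq0 // gt_eqF.
have : \forall a \near x, invgeom k a < y by exact: (cvgr_lt _ cts y xy).
move=> /nbhs_ballP[e /= e0 He].
exists (Num.max (x / 2) (x - e)); first by rewrite lt_max gt_max; lra.
move=> a; rewrite gt_max => /andP[a1 a2] ax; apply: He.
by rewrite /ball /= ger0_norm; lra.
Qed.

(** It suffices that each path sit on the threshold set by the other: [(1 - b) * geom p x = x ^+ p]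
    and [(1 - x) * geom q b = b ^+ q]. [F] solves the first equation for [b]; [psi] is the defect of
    the second, positive at 0 and negative at 1. *)
Lemma path_system_exists p q : (2 <= p)%N -> (2 <= q)%N ->
  exists alpha beta, [/\ 0 < alpha < 1, 0 < beta < 1 & path_system p q alpha beta].
Proof.
move=> p2 q2.
have p0 : (0 < p)%N by lia.
have q0 : (0 < q)%N by lia.
pose F x : R := 1 - x ^+ p / geom p x.
pose psi x := (1 - x) * geom q (F x) - F x ^+ q.
have geomC k x : (@geom R k) @ x --> geom k x.
  by apply: (@continuous_sum_ord k (fun i a => a ^+ i)) => i; exact: exprn_continuous.
have FC x : 0 <= x -> F @ x --> F x.
  move=> x0; apply: cvgB; first exact: cvg_cst.
  apply: cvgM; first exact: exprn_continuous.
  by apply: cvgV; [rewrite gt_eqF // geom_gt0|exact: geomC].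
have psiC x : 0 <= x -> psi @ x --> psi x.
  move=> x0; apply: cvgB.
    apply: cvgM; first by apply: cvgB; [exact: cvg_cst|exact: cvg_id].
    exact: (cvg_comp _ _ (FC x x0) (geomC q (F x))).
  exact: (cvg_comp _ _ (FC x x0) (@exprn_continuous R q (F x))).
have geom0 k : (0 < k)%N -> geom k (0 : R) = 1.
  case: k => // k _; rewrite /geom big_ord_recl expr0 big1 ?addr0 // => i _.
  by rewrite expr0n.
have geom1 k : geom k (1 : R) = k%:R.
  rewrite /geom (eq_bigr (fun=> 1)); last by move=> i _; rewrite expr1n.
  by rewrite sumr_const card_ord.
have psi0 : 0 < psi 0.
  rewrite /psi /F expr0n gtn_eqF //= mul0r !subr0 mul1r expr1n geom1 subr_gt0.
  by rewrite ltr1n; lia.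
have F1 : 0 < F 1.
  by rewrite /F geom1 expr1n mul1r subr_gt0 invf_lt1 ?ltr1n ?ltr0n.
have psi1 : psi 1 < 0 by rewrite /psi subrr mul0r sub0r oppr_lt0 exprn_gt0.
have [||x /itvP Hx xE] := @IVT R psi 0 1 0 ler01.
- apply: continuous_in_subspaceT => x; rewrite inE /= in_itv /= => /andP[x0 _].
  exact: psiC.
- by rewrite ge_min le_max (ltW psi1) (ltW psi0) orbT.
have x0 : 0 < x.
  rewrite lt_neqAle Hx andbT; apply/eqP => x0.
  by move: xE psi0; rewrite -x0 => ->; rewrite ltxx.
have x1 : x < 1.
  rewrite lt_neqAle Hx andbT; apply/eqP => x1.
  by move: xE psi1; rewrite x1 => ->; rewrite ltxx.
have xp0 : 0 < x ^+ p by rewrite exprn_gt0.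
have gp : x ^+ p < geom p x.
  have := geomE p x; have : x ^+ p < 1 by rewrite exprn_ilt1 ?gtn_eqF // ltW.
  case: (p) p2 => [//|k] k2; rewrite /geom big_ord_recl expr0 => H _.
  by rewrite ltr_wpDr //; apply: sumr_ge0 => i _; rewrite exprn_ge0 // ltW.
have gp0 : 0 < geom p x by rewrite geom_gt0 // ltW.
have b0 : 0 < F x by rewrite subr_gt0 ltr_pdivrMr // mul1r.
have b1 : F x < 1 by rewrite gtrDl oppr_lt0 divr_gt0.
exists x, (F x); split; rewrite ?x0 ?b0 //.
set b := F x in b0 b1 *.
have E1 : (1 - b) * geom p x = x ^+ p.
  by rewrite /b /F opprB addrC subrK divfK // gt_eqF.
have E2 : (1 - x) * geom q b = b ^+ q by apply/eqP; rewrite -subr_eq0; apply/eqP.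
have Ga := geomE p x; have Gb := geomE q b.
have P1 : (1 - b) * (1 - x ^+ p) = x ^+ p * (1 - x) by rewrite -Ga -E1; ring.
have P2 : (1 - x) * (1 - b ^+ q) = b ^+ q * (1 - b) by rewrite -Gb -E2; ring.
(* The product of [P1] and [P2], divided by [(1 - x) * (1 - b)], reads [x ^+ p * b ^+ q = (1 - x ^+
   p) * (1 - b ^+ q)]. *)
have S1 : x ^+ p + b ^+ q = 1.
  have nz : (1 - x) * (1 - b) != 0 by rewrite mulf_neq0 // subr_eq0 gt_eqF.
  apply: (mulfI nz); apply/eqP; rewrite -subr_eq0; apply/eqP.
  have -> : (1 - x) * (1 - b) * (x ^+ p + b ^+ q) - (1 - x) * (1 - b) * 1 =
    x ^+ p * (1 - x) * (b ^+ q * (1 - b)) -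
    (1 - b) * (1 - x ^+ p) * ((1 - x) * (1 - b ^+ q)) by ring.
  by rewrite P1 P2 subrr.
by split=> //; rewrite -P1 -S1; ring.
Qed.

End System.

(** * Two paths feeding back on each other *)

Section TwoPaths.
Variables (R : realType) (p q : nat) (w v : nat -> nat -> R) (alpha beta : R).
Hypotheses (p2 : (2 <= p)%N) (q2 : (2 <= q)%N).
Hypotheses (w0 : forall k n, 0 < w k n) (v0 : forall k n, 0 < v k n).
Hypothesis v1 : forall k n, v k n <= 1.
Hypothesis dw : driven p w (resistance v q).
Hypothesis dv : driven q v (resistance w p).
Hypotheses (aI : 0 < alpha < 1) (bI : 0 < beta < 1).
Hypothesis sys : path_system p q alpha beta.

Lemma resistance_gt0 (u : nat -> nat -> R) k n : (0 < k)%N ->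
  (forall k n, 0 < u k n) -> 0 < resistance u k n.
Proof.
case: k => // k _ u0; rewrite /resistance big_ord_recl ltr_pwDl ?invr_gt0 //.
by apply: sumr_ge0 => i _; rewrite invr_ge0 ltW.
Qed.

(* Otherwise, let [l < alpha] be the supremum of the admissible [a]. A lower
   bound close to [l] on the first path gives an upper bound on the second
   one, which by [path_system_gap] gives a lower bound beyond [l] on the first
   path. *)
Lemma two_paths_ge a : 0 < a < alpha ->
  \forall n \near \oo, forall k, (k < p)%N -> a ^+ k.+1 <= w k n.
Proof.
have p0 : (0 < p)%N by lia.
have q0 : (0 < q)%N by lia.
have [/andP[a0 a1] /andP[b0 b1]] := (aI, bI).
pose low a := \forall n \near \oo, forall k, (k < p)%N -> a ^+ k.+1 <= w k n.
have lowS x y : 0 < x -> x <= y -> low y -> low x.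
  move=> x0 xy; apply: filterS => n H k kp; apply: le_trans (H k kp).
  by rewrite lerXn2r ?nnegrE ?(ltW x0) ?(le_trans (ltW x0) xy).
have B0 n : 0 < resistance v q n by exact: resistance_gt0.
have A0 n : 0 < resistance w p n by exact: resistance_gt0.
pose L := [set x | 0 < x < alpha /\ low x].
have Lne : exists x, L x.
  (* Starting bound: as [v <= 1], the second path has normalized resistance at least [q >= 2], and
     [2 * (1 - x) > 1] since [x <= 1 / 4]. *)
  pose x := Num.min (alpha / 2) 4^-1.
  have x0 : 0 < x by rewrite lt_min; lra.
  have x1 : x <= alpha / 2 by rewrite ge_min lexx.
  have x2 : x <= 4^-1 by rewrite ge_min lexx orbT.
  exists x; split; first by lra.
  apply: (@driven_ge _ _ _ _ _ 2) dw _ _ _ => //; try lra.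
  near=> n; apply: (@le_trans _ _ q%:R); first by rewrite (ler_nat _ 2).
  rewrite -[q in leLHS]card_ord -sumr_const; apply: ler_sum => i _.
  by rewrite -[leLHS]invr1 lef_pV2 ?posrE.
have Lub : has_sup L by split=> //; exists alpha => x [/andP[_ /ltW]].
pose l := sup L.
have [x0 Lx0] := Lne.
have l0 : 0 < l.
  have [/andP[x00 _] _] := Lx0.
  by apply: lt_le_trans x00 _; exact: ub_le_sup (proj2 Lub) _ Lx0.
suff lalpha : alpha <= l.
  move=> /andP[a00 aalpha].
  have [x [_ Lx] xa] := @sup_adherent _ L (l - a) ltac:(lra) Lub.
  by apply: lowS Lx => //; move: xa; rewrite -/l; lra.
rewrite leNgt; apply/negP => lalpha.
have [b [bb Hb1 Hb2]] :=
  path_system_gap p2 q2 aI bI sys (introT andP (conj l0 lalpha)).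
have /andP[b00 b11] := bb.
(* The supremum [l] may fail to be admissible, so the improvement starts from an admissible [x]
   close to it, where continuity preserves [Hb1]. *)
have [y [y0 yl Hy]] : exists y, [/\ 0 < y, y < l & forall x, y < x -> x <= l ->
    invgeom p x < (1 - b)^-1].
  have [|y /andP[y0 yl] Hy] := @invgeom_left_continuous _ p l (1 - b)^-1 l0.
    by rewrite -[ltRHS]mul1r ltr_pdivlMr // subr_gt0.
  by exists y.
have [x Lx xy] := @sup_adherent _ L (l - y) ltac:(lra) Lub.
have xl : x <= l by exact: ub_le_sup (proj2 Lub) _ Lx.
have [/andP[x00 xalpha] lowx] := Lx.
have Hx : invgeom p x * (1 - b) < 1.
  rewrite -ltr_pdivlMr ?subr_gt0 // mul1r; apply: Hy => //.
  by move: xy; rewrite -/l; lra.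
have Hv := driven_le v0 A0 dv bb Hx (invgeom_gt0 p0 x00)
  (near_resistance_le x00 lowx).
have HB := near_resistance_ge b00 v0 Hv.
set y' := invgeom q b in Hb2 HB.
have y'0 : 0 < y' by rewrite invgeom_gt0.
have y'l : l < 1 - y'^-1.
  by have := Hb2; rewrite -ltr_pdivrMl // mulr1; lra.
(* Above [l], but below [alpha] and below the threshold [1 - 1 / y'] of [driven_ge]. *)
pose a' := Num.min ((l + alpha) / 2) ((l + (1 - y'^-1)) / 2).
have la' : l < a' by rewrite lt_min; lra.
have a'1 : a' <= (l + alpha) / 2 by rewrite ge_min lexx.
have a'2 : a' <= (l + (1 - y'^-1)) / 2 by rewrite ge_min lexx orbT.
have La' : L a'.
  split; first lra.
  apply: driven_ge w0 B0 dw _ _ HB; first by lra.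
  by rewrite -ltr_pdivrMl // mulr1; lra.
by have := ub_le_sup (proj2 Lub) La'; rewrite leNgt la'.
Unshelve. all: by end_near. Qed.

(** Since [invgeom p alpha * (1 - beta) = 1], any [b > beta] leaves enough slack to apply
    [driven_le] with a lower bound [x < alpha] on the first path. *)
Lemma two_paths_le b : beta < b < 1 ->
  \forall n \near \oo, forall k, (k < q)%N -> v k n <= b ^+ k.+1.
Proof.
move=> /andP[bb b1].
have p0 : (0 < p)%N by lia.
have [/andP[a0 a1] /andP[b0 _]] := (aI, bI).
have A0 n : 0 < resistance w p n by exact: resistance_gt0.
have := path_system_invgeom aI bI sys => Hab.
have [|y /andP[y0 yl] Hy] := @invgeom_left_continuous _ p alpha (1 - b)^-1 a0.
  rewrite -[ltRHS]mul1r ltr_pdivlMr ?subr_gt0 // -[ltRHS]Hab.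
  by rewrite ltr_pM2l ?invgeom_gt0 //; lra.
pose x := (y + alpha) / 2.
have x0 : 0 < x by rewrite /x; lra.
have Hx : invgeom p x * (1 - b) < 1.
  by rewrite -ltr_pdivlMr ?subr_gt0 // mul1r; apply: Hy; rewrite /x; lra.
apply: (driven_le v0 A0 dv _ Hx (invgeom_gt0 p0 x0)); first by lra.
by apply: near_resistance_le => //; apply: two_paths_ge; rewrite /x; lra.
Qed.

End TwoPaths.

Lemma path_system_sym (R : realType) p q (alpha beta : R) :
  path_system p q alpha beta -> path_system q p beta alpha.
Proof. by case=> H1 H2; split=> //; rewrite addrC. Qed.

(** [w k] is squeezed between powers of numbers close to [alpha]; the upper bound is [two_paths_le]
    with the two paths exchanged. *)
Lemma two_paths_cvg (R : realType) p q (w v : nat -> nat -> R) (alpha beta : R) :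
  (2 <= p)%N -> (2 <= q)%N ->
  (forall k n, 0 < w k n <= 1) -> (forall k n, 0 < v k n <= 1) ->
  driven p w (resistance v q) -> driven q v (resistance w p) ->
  0 < alpha < 1 -> 0 < beta < 1 -> path_system p q alpha beta ->
  forall k, (k < p)%N -> w k @ \oo --> alpha ^+ k.+1.
Proof.
move=> p2 q2 w01 v01 dw dv aI bI sys k kp.
have w0 i n : 0 < w i n by have /andP[] := w01 i n.
have v0 i n : 0 < v i n by have /andP[] := v01 i n.
have w1 i n : w i n <= 1 by have /andP[] := w01 i n.
have v1 i n : v i n <= 1 by have /andP[] := v01 i n.
have /andP[a0 a1] := aI.
apply/cvgrPdist_le => e e0.
have /cvgrPdist_le/(_ e e0)/nbhs_ballP[d /= d0 Hd] :=
  @exprn_continuous R k.+1 alpha.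
pose x := Num.max (alpha / 2) (alpha - d / 2).
have x1 : alpha / 2 <= x by rewrite le_max lexx.
have x2 : alpha - d / 2 <= x by rewrite le_max lexx orbT.
have x3 : x < alpha by rewrite gt_max; lra.
pose y := Num.min ((alpha + 1) / 2) (alpha + d / 2).
have y1 : y <= (alpha + 1) / 2 by rewrite ge_min lexx.
have y2 : y <= alpha + d / 2 by rewrite ge_min lexx orbT.
have y3 : alpha < y by rewrite lt_min; lra.
have xI : 0 < x < alpha by lra.
have yI : alpha < y < 1 by lra.
have Hlo := two_paths_ge p2 q2 w0 v0 v1 dw dv aI bI sys xI.
have Hup := two_paths_le q2 p2 v0 w0 w1 dv dw bI aI (path_system_sym sys) yI.
have := Hd x; rewrite /ball /= => /(_ _)/ler_normlP[|_ Hx].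
  by rewrite ger0_norm; lra.
have := Hd y; rewrite /ball /= => /(_ _)/ler_normlP[|Hy _].
  by rewrite ltr0_norm; lra.
apply: filterS2 Hlo Hup => n /(_ k kp) Hn1 /(_ k kp) Hn2.
by rewrite ler_norml; apply/andP; split; lra.
Qed.

(** * Convergence of a martingale on a tree *)

Section RealProbability.
Context d (T : measurableType d) (R : realType) (P : probability T R).
Implicit Types A B D : set T.

Definition pr A : R := fine (P A).

Lemma prE A : measurable A -> P A = (pr A)%:E.
Proof. by move=> mA; rewrite /pr fineK // fin_num_measure. Qed.

Lemma pr_ge0 A : 0 <= pr A.
Proof. exact/fine_ge0/measure_ge0. Qed.

Lemma le_pr A B : measurable A -> measurable B -> A `<=` B -> pr A <= pr B.
Proof.
move=> mA mB AB; rewrite -lee_fin -!prE //.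
by apply: le_measure; rewrite ?inE.
Qed.

Lemma pr_setU A B : measurable A -> measurable B -> A `&` B = set0 ->
  pr (A `|` B) = pr A + pr B.
Proof.
move=> mA mB AB; apply: EFin_inj.
by rewrite EFinD -!prE ?measureU //; exact: measurableU.
Qed.

Lemma pr_set0 : pr set0 = 0.
Proof. by rewrite /pr measure0. Qed.

Lemma pr_bigsetU_le (I : eqType) (s : seq I) (F : I -> set T) :
  (forall i, measurable (F i)) ->
  measurable [set t | exists2 i, i \in s & F i t] /\
  pr [set t | exists2 i, i \in s & F i t] <= \sum_(i <- s) pr (F i).
Proof.
move=> mF; elim: s => [|i s [mU leU]].
  rewrite big_nil (_ : [set t | _] = set0) ?pr_set0 //.
  by apply/seteqP; split=> // t [].
rewrite (_ : [set t | _] = F i `|` [set t | exists2 i, i \in s & F i t]).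
  split; first exact: measurableU.
  rewrite big_cons; apply: le_trans (lerD (lexx _) leU).
  by rewrite -lee_fin EFinD -!prE ?measureU2 //; exact: measurableU.
apply/seteqP; split=> [t [j]|t [Fi|[j js Fj]]].
- by rewrite inE => /predU1P[->|js] Fj; [left|right; exists j].
- by exists i => //; rewrite inE eqxx.
- by exists j => //; rewrite inE js orbT.
Qed.

Lemma pr_split (G : finType) (xi : T -> G) D :
  (forall a, measurable [set t | xi t = a]) -> measurable D ->
  pr D = \sum_a pr (D `&` [set t | xi t = a]).
Proof.
move=> mxi mD.
suff H (s : seq G) : uniq s -> measurable [set t | xi t \in s] /\
    pr (D `&` [set t | xi t \in s]) = \sum_(a <- s) pr (D `&` [set t | xi t = a]).
  have [_] := H _ (enum_uniq G); rewrite big_enum => <-; congr pr.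
  by apply/seteqP; split=> t; [move=> Dt; split; rewrite //= mem_enum|case].
elim: s => [_|a s IHs /= /andP[as_ us]].
  rewrite big_nil (_ : [set t | _] = set0) ?setI0 ?pr_set0 //.
  by apply/seteqP; split.
have [ms IH] := IHs us.
rewrite (_ : [set t | _] = [set t | xi t = a] `|` [set t | xi t \in s]).
  split; first exact: measurableU.
  rewrite setIUr pr_setU ?big_cons ?IH //; try exact: measurableI.
  apply/seteqP; split=> // t [[_ /= ta] [_ /= ts]].
  by move: as_; rewrite -ta ts.
apply/seteqP; split=> t /=; first by rewrite inE => /predU1P[]; [left|right].
by case=> [->|ts]; rewrite inE ?eqxx ?ts ?orbT.
Qed.

End RealProbability.

Section TreeMartingale.
Context d (T : measurableType d) (R : realType) (P : probability T R).
Variables (G : finType) (xi : nat -> T -> G).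
Hypothesis mxi : forall n a, measurable [set t | xi n t = a].
Implicit Types (g : seq G) (f M A : seq G -> R).

(* Newest observation first. *)
Fixpoint history n t : seq G :=
  if n is m.+1 then xi m t :: history m t else [::].

Fixpoint histories n : seq (seq G) :=
  if n is m.+1 then [seq a :: g | a <- enum G, g <- histories m] else [:: [::]].

Definition cylinder g : set T := [set t | history (size g) t = g].

(** Expectation of a function of the first [n] observations, which take finitely many values: a
    finite sum replaces the integral. *)
Definition mean n f : R := \sum_(g <- histories n) pr P (cylinder g) * f g.

Lemma size_history n t : size (history n t) = n.
Proof. by elim: n => //= n ->. Qed.

Lemma mem_histories n t : history n t \in histories n.
Proof.
elim: n => [|n IHn] //=.
by apply/allpairsP; exists (xi n t, history n t); rewrite /= mem_enum.
Qed.

Lemma size_histories n g : g \in histories n -> size g = n.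
Proof.
elim: n g => [|n IHn] g /=; first by rewrite inE => /eqP->.
by move=> /allpairsP[[a g'] /= [_ /IHn <- ->]].
Qed.

Lemma cylinder_cons a g :
  cylinder (a :: g) = cylinder g `&` [set t | xi (size g) t = a].
Proof.
apply/seteqP; split=> t; rewrite /cylinder /=; first by case=> <- ->.
by case=> -> ->.
Qed.

Lemma measurable_cylinder g : measurable (cylinder g).
Proof.
elim: g => [|a g IHg]; last by rewrite cylinder_cons; exact: measurableI.
by rewrite (_ : cylinder _ = setT) //; apply/seteqP; split.
Qed.

Lemma pr_cylinder_split g :
  pr P (cylinder g) = \sum_a pr P (cylinder (a :: g)).
Proof.
rewrite (pr_split P (mxi (size g)) (measurable_cylinder g)).
by apply: eq_bigr => a _; rewrite cylinder_cons.
Qed.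

Lemma meanS n f : mean n.+1 f =
  \sum_(g <- histories n) \sum_a pr P (cylinder (a :: g)) * f (a :: g).
Proof.
rewrite /mean /= big_allpairs_dep /= exchange_big /=.
by apply: eq_bigr => g _; rewrite big_enum.
Qed.

Lemma mean_ge0 n f : (forall g, 0 <= f g) -> 0 <= mean n f.
Proof. by move=> f0; apply: sumr_ge0 => g _; rewrite mulr_ge0 ?pr_ge0. Qed.

Lemma measurable_history n (Q : pred (seq G)) :
  measurable [set t | Q (history n t)] /\
  pr P [set t | Q (history n t)] <= mean n (fun g => (Q g)%:R).
Proof.
have [mU leU] := pr_bigsetU_le P [seq g <- histories n | Q g] measurable_cylinder.
have EU : [set t | Q (history n t)] =
    [set t | exists2 g, g \in [seq g <- histories n | Q g] & cylinder g t].
  apply/seteqP; split=> t /=.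
    move=> Qt; exists (history n t); first by rewrite mem_filter Qt mem_histories.
    by rewrite /cylinder /= size_history.
  case=> g; rewrite mem_filter => /andP[Qg /size_histories sg].
  by rewrite /cylinder /= sg => ->.
rewrite EU; split=> //; apply: (le_trans leU).
rewrite big_filter big_mkcond /=; apply: ler_sum => g _.
by case: (Q g); rewrite ?mulr1 ?mulr0.
Qed.

(* Freezing the martingale at its first large value turns the bound on its
   final variance into a bound on the probability of a large oscillation. *)
Fixpoint excursion M m lam g : R :=
  if g is a :: g' then
    let z := excursion M m lam g' in
    if (size g' < m)%N || (lam <= `|z|) then z else z + (M (a :: g') - M g')
  else 0.

(** [A] is a nonincreasing budget that pays for the conditional variances of [M]. Conditional
    expectations appear multiplied by the probability of the cylinder, which avoids dividing by
    0. *)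
Variables M A : seq G -> R.
Hypothesis A_ge0 : forall g, 0 <= A g.
Hypothesis A_cons : forall a g, A (a :: g) <= A g.
Hypothesis M_mart : forall g,
  \sum_a pr P (cylinder (a :: g)) * (M (a :: g) - M g) = 0.
Hypothesis M_var : forall g,
  \sum_a pr P (cylinder (a :: g)) * (M (a :: g) - M g) ^+ 2 <=
  \sum_a pr P (cylinder (a :: g)) * (A g - A (a :: g)).

(** [Z ^+ 2 + A] is a supermartingale: the cross term vanishes by [M_mart], and [M_var] makes the
    decrease of [A] pay for the square. *)
Lemma excursion_step m lam g (Z := excursion M m lam) :
  \sum_a pr P (cylinder (a :: g)) * (Z (a :: g) ^+ 2 + A (a :: g)) <=
  pr P (cylinder g) * (Z g ^+ 2 + A g).
Proof.
rewrite pr_cylinder_split mulr_suml /Z /=; case: (_ || _).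
  by apply: ler_sum => a _; rewrite ler_wpM2l ?pr_ge0 // lerD2l.
set z := excursion M m lam g.
have -> : \sum_a pr P (cylinder (a :: g)) *
      ((z + (M (a :: g) - M g)) ^+ 2 + A (a :: g)) =
    \sum_a pr P (cylinder (a :: g)) * (z ^+ 2 + A g) +
    (2 * z) * (\sum_a pr P (cylinder (a :: g)) * (M (a :: g) - M g)) +
    (\sum_a pr P (cylinder (a :: g)) * (M (a :: g) - M g) ^+ 2 -
     \sum_a pr P (cylinder (a :: g)) * (A g - A (a :: g))).
  rewrite mulr_sumr -sumrB -!big_split /=; apply: eq_bigr => a _; ring.
by rewrite M_mart mulr0 addr0 gerDl subr_le0.
Qed.

Lemma excursion_start m lam g : (size g <= m)%N -> excursion M m lam g = 0.
Proof. by elim: g => //= a g IHg gm; rewrite gm /= IHg // ltnW. Qed.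

Lemma mean_excursion m lam n (Z := excursion M m lam) :
  mean (m + n) (fun g => Z g ^+ 2) + mean (m + n) A <= mean m A.
Proof.
have meanD k f1 f2 : mean k f1 + mean k f2 = mean k (fun g => f1 g + f2 g).
  by rewrite /mean -big_split; apply: eq_bigr => g _; rewrite mulrDr.
rewrite meanD; elim: n => [|n IHn].
  rewrite addn0 /mean big_seq [leRHS]big_seq; apply: ler_sum => g gm.
  by rewrite /Z excursion_start ?(size_histories gm) // expr0n add0r.
apply: le_trans IHn; rewrite addnS meanS; apply: ler_sum => g _.
exact: excursion_step.
Qed.

Lemma mean_A_le m n : mean (m + n) A <= mean m A.
Proof.
apply: le_trans (mean_excursion m 0 n); rewrite lerDr.
by apply: mean_ge0 => g; exact: sqr_ge0.
Qed.

(** The means of [A] decrease and are nonnegative, so they converge; by [mean_excursion] the gap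
    bounds the variance accumulated after time [m]. *)
Lemma mean_A_gap e : 0 < e -> exists m, forall n, mean m A - mean (m + n) A <= e.
Proof.
move=> e0; have A0 n : 0 <= mean n A by exact: mean_ge0.
have /cvg_ex[/= l Hl] : cvgn (fun n => mean n A).
  apply: nonincreasing_is_cvgn; first by move=> m n /subnKC <-; exact: mean_A_le.
  by exists 0 => _ [n _ <-].
have e2 : 0 < e / 2 by rewrite divr_gt0.
have [m _ Hm] := (cvgrPdist_le _ _).1 Hl _ e2.
exists m => n; have := Hm m (leqnn m); have := Hm (m + n)%N (leq_addr n m).
by rewrite /= !ler_norml => /andP[_ h1] /andP[h2 _]; lra.
Qed.

Lemma excursion_history m lam t n : 0 < lam ->
  (exists2 k, (k <= n)%N & lam <= `|M (history (m + k) t) - M (history m t)|) ->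
  lam <= `|excursion M m lam (history (m + n) t)|.
Proof.
move=> lam0; pose Z k := excursion M m lam (history (m + k) t).
have Z0 : Z 0 = 0 by rewrite /Z addn0 excursion_start ?size_history.
have ZS k : Z k.+1 = if lam <= `|Z k| then Z k else
    Z k + (M (history (m + k.+1) t) - M (history (m + k) t)).
  by rewrite /Z addnS /= size_history ltnNge leq_addr.
have hit k j : lam <= `|Z k| -> lam <= `|Z (k + j)%N|.
  by move=> H; elim: j => [|j IHj]; rewrite ?addn0 // addnS ZS IHj.
have Zk k : (lam <= `|Z k|) \/ Z k = M (history (m + k) t) - M (history m t).
  elim: k => [|k [Zk|Zk]]; first by right; rewrite Z0 addn0 subrr.
    by left; rewrite ZS Zk.
  rewrite ZS; case: ifP => [H|_]; first by left.
  by right; rewrite Zk; ring.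
case=> k /subnKC <- Hk; apply: hit.
by case: (Zk k) => // ->.
Qed.

Lemma pr_excursion_le m lam e n : 0 < lam ->
  mean m A - mean (m + n) A <= e ->
  pr P [set t | lam <= `|excursion M m lam (history (m + n) t)|] <= e / lam ^+ 2.
Proof.
move=> lam0 gap; set Z := excursion M m lam.
have [_ H] := measurable_history (m + n) (fun g => lam <= `|Z g|).
apply: (le_trans H); rewrite ler_pdivlMr ?exprn_gt0 // /mean mulr_suml.
apply: (@le_trans _ _ (mean (m + n) (fun g => Z g ^+ 2))).
  apply: ler_sum => g _; rewrite -mulrA ler_wpM2l ?pr_ge0 //.
  have [Hg|_] := boolP (lam <= `|Z g|); last by rewrite mul0r sqr_ge0.
  rewrite mul1r -[leRHS]real_normK ?num_real // lerXn2r ?nnegrE //.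
  exact: ltW.
by rewrite (le_trans _ gap) // lerBrDr; exact: mean_excursion.
Qed.

Lemma oscillation_negligible lam : 0 < lam ->
  P.-negligible [set t | forall m, exists n,
    lam <= `|M (history (m + n) t) - M (history m t)|].
Proof.
move=> lam0.
pose E m n := [set t | lam <= `|excursion M m lam (history (m + n) t)|].
have mE m n : measurable (E m n).
  by have [] := measurable_history (m + n) (fun g => lam <= `|excursion M m lam g|).
have mU m : measurable (\bigcup_n E m n) by exact: bigcup_measurable.
exists (\bigcap_m \bigcup_n E m n); split.
- exact: bigcap_measurableType.
- apply/eqP; rewrite eq_le measure_ge0 andbT.
  apply/lee_addgt0Pr => e e0; rewrite add0e.
  have [|m Hm] := mean_A_gap (_ : 0 < e * lam ^+ 2).
    by rewrite mulr_gt0 // exprn_gt0.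
  apply: (@le_trans _ _ (P (\bigcup_n E m n))).
    apply: le_measure; rewrite ?inE //; first exact: bigcap_measurableType.
    exact: bigcap_inf.
  (* A frozen value is kept, so [E m n] grows with [n], and the bound, uniform in [n], passes to the
     union. *)
  have mono : {homo E m : i j / (i <= j)%N >-> (i <= j)%O}.
    move=> i j /subnKC <-; apply/subsetPset => t.
    rewrite /E /= => Et; elim: (j - i)%N => [|k IHk]; first by rewrite addn0.
    by rewrite addnS addnS /= size_history ltnNge leq_addr /= IHk.
  have cvgE := @nondecreasing_cvg_mu _ _ _ P _ (mE m) (mU m) mono.
  apply: (cvge_to_le cvgE); apply: nearW => n /=.
  rewrite (prE P (mE m n)) lee_fin (le_trans (pr_excursion_le lam0 (Hm n))) //.
  by rewrite mulfK // gt_eqF // exprn_gt0.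
- move=> t Ht m _; have [n Hn] := Ht m.
  by exists n => //; apply: excursion_history => //; exists n.
Qed.

(** Outside countably many null sets the oscillation after some time is below each [j.+1%:R^-1]: the
    sequence is Cauchy. *)
Lemma tree_martingale_cvg : {ae P, forall t, cvgn (fun n => M (history n t))}.
Proof.
have /negligible_bigcup : forall j : nat, P.-negligible [set t | forall m, exists n,
    j.+1%:R^-1 <= `|M (history (m + n) t) - M (history m t)|].
  by move=> j; apply: oscillation_negligible; rewrite invr_gt0.
apply: negligibleS => t /= Ht; apply: contrapT => Hno; apply: Ht.
apply/cauchy_cvgP/cauchyP => e e0.
have [j Hj] : exists j : nat, j.+1%:R^-1 <= e.
  exists (Num.truncn e^-1); rewrite -[leRHS]invrK lef_pV2 ?posrE ?invr_gt0 //.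
  by apply/ltW; rewrite truncnS_gt.
have [m Hm] : exists m, forall n,
    `|M (history (m + n) t) - M (history m t)| < j.+1%:R^-1.
  apply: contrapT => H; apply: Hno; exists j => // m.
  apply: contrapT => H'; apply: H; exists m => n; rewrite ltNge.
  by apply/negP => Hn; apply: H'; exists n.
exists (M (history m t)); exists m => // n /= /subnKC <-.
by rewrite /ball /= distrC (lt_le_trans (Hm _)).
Qed.

End TreeMartingale.

(** * Crossing probabilities *)

Section MoreProbability.
Context d (T : measurableType d) (R : realType) (P : probability T R).
Implicit Types A B C E : set T.

Lemma pr_ae_le A B : measurable A -> measurable B ->
  {ae P, forall t, A t -> B t} -> pr P A <= pr P B.
Proof.
move=> mA mB AB; have mD : measurable (A `\` B) by exact: measurableD.
have D0 : P (A `\` B) = 0%E.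
  apply: measure_negligible => //; apply: negligibleS AB => t [At nBt] /= H.
  exact: nBt (H At).
rewrite -lee_fin -!prE // (@le_trans _ _ (P (B `|` A `\` B))) //.
  apply: le_measure; rewrite ?inE //; first exact: measurableU.
  by move=> t At; have [Bt|nBt] := pselect (B t); [left|right].
apply: le_trans (measureU2 P mB mD) _.
by rewrite /= D0 adde0.
Qed.

Lemma pr_ae_eq A B : measurable A -> measurable B ->
  {ae P, forall t, A t <-> B t} -> pr P A = pr P B.
Proof.
move=> mA mB AB; apply/eqP; rewrite eq_le; apply/andP; split.
  by apply: pr_ae_le => //; apply: filterS AB => t [].
by apply: pr_ae_le => //; apply: filterS AB => t [].
Qed.

(** Total probability over the values of [Z]; [pickle] numbers them, which writes [C] as a disjoint
    union indexed by [nat]. *)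
Lemma pr_mixture (Y : countType) (Z : T -> Y) C E (c : R) : 0 <= c ->
  measurable C -> measurable E -> (forall y, measurable [set t | Z t = y]) ->
  (forall y, pr P (C `&` [set t | Z t = y] `&` E) =
             pr P (C `&` [set t | Z t = y]) * c) ->
  pr P (C `&` E) = pr P C * c.
Proof.
move=> c0 mC mE mZ H.
pose F k := C `&` [set t | pickle (Z t) = k].
have FE k : (exists y, F k = C `&` [set t | Z t = y]) \/ F k = set0.
  have [y|nz] := pselect (exists y : Y, pickle y = k); last first.
    by right; apply/seteqP; split=> // t [_ /= zk]; apply: nz; exists (Z t).
  case: y => y <-; left; exists y; congr (C `&` _).
  apply/seteqP; split=> t /= => [/(pcan_inj pickleK)//|->//].
have mF k : measurable (F k).
  by case: (FE k) => [[y ->]|->] //; exact: measurableI.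
have tF (D : set T) : trivIset setT (fun k => F k `&` D).
  by apply/trivIsetP => i j _ _ /eqP ij; apply/seteqP; split=> // t
    [[[_ /= h1] _] [[_ /= h2] _]]; apply: ij; rewrite -h1 -h2.
have UF (D : set T) : C `&` D = \bigcup_k (F k `&` D).
  apply/seteqP; split=> [t [Ct Dt]|t [k _ [[Ct _] Dt]]] //.
  by exists (pickle (Z t)).
apply: EFin_inj; rewrite EFinM -!prE //; last exact: measurableI.
rewrite UF -[C in RHS]setIT UF !measure_bigcup //; first last.
- by move=> k _; exact: measurableI.
- by move=> k _; exact: measurableI.
rewrite muleC -nneseriesZl; last by move=> k _; exact: measure_ge0.
apply: eq_eseriesr => k _; rewrite setIT /= !prE //; last exact: measurableI.
rewrite -EFinM; congr _%:E; case: (FE k) => [[y ->]|->].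
  by rewrite H mulrC.
by rewrite set0I pr_set0 mulr0.
Qed.

End MoreProbability.

(** * Running and stopped walks *)

Section Walk.
Variable G : ant_graph.
Implicit Types (u : vertex G) (e : edge G) (s r : seq (edge G)).

Lemma running_walk_end u s : running_walk u s -> walk_end u s != food G.
Proof. by elim: s u => [|e s IHs] u /= /andP[] // _ /andP[_ /IHs]. Qed.

Lemma running_not_stopped u s : running_walk u s -> ~~ stopped_walk u s.
Proof.
elim: s u => [|e s IHs] u /= /andP[uF]; first by [].
by case/andP=> _ /IHs /negPf ->; rewrite !andbF.
Qed.

Lemma walk_end_rcons u s e : walk_end u (rcons s e) = opposite (walk_end u s) e.
Proof. by rewrite /walk_end -cats1 foldl_cat. Qed.

Lemma running_walk_rcons u s e : running_walk u s -> incident e (walk_end u s) ->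
  opposite (walk_end u s) e != food G -> running_walk u (rcons s e).
Proof.
elim: s u => [|e' s IHs] u /= /andP[-> H] inc opp /=.
  by rewrite inc opp.
by case/andP: H => -> /IHs ->.
Qed.

Lemma stopped_walk_rcons u s e : running_walk u s -> incident e (walk_end u s) ->
  opposite (walk_end u s) e = food G -> stopped_walk u (rcons s e).
Proof.
elim: s u => [|e' s IHs] u /= /andP[-> H] inc opp /=.
  by rewrite inc opp eqxx.
by case/andP: H => -> /IHs ->.
Qed.

Lemma stopped_walk_prefix u s r : stopped_walk u s -> stopped_walk u r ->
  prefix s r -> r = s.
Proof.
elim: s u r => [|e s IHs] u [|e' r] //=.
  by move=> /eqP->; rewrite eqxx.
move=> /and3P[_ _ Hs] /and3P[_ _ Hr] /andP[/eqP ee sr]; subst e'.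
by rewrite (IHs _ _ Hs Hr sr).
Qed.

End Walk.

Lemma prefix_rcons_nth (E : eqType) (x0 e : E) (s r : seq E) :
  prefix (rcons s e) r = [&& prefix s r, size s < size r & nth x0 r (size s) == e]%N.
Proof.
elim: s r => [|a s IHs] [|b r] //=; first by rewrite prefix0s eq_sym andbT.
by rewrite IHs ltnS andbA.
Qed.

(** * Law of one walk given the past *)

Section Crossing.
Context (R : realType) (G : ant_graph) d (T : measurableType d).
Context (P : probability T R) (X : nat -> T -> seq (edge G)).
Hypothesis antX : is_ant_process P X.

Lemma measurable_walk n (S : set (seq (edge G))) : measurable [set t | S (X n t)].
Proof.
rewrite (_ : [set t | _] = \bigcup_s [set t | X n t = s /\ S s]).
  apply: countable_bigcupT_measurable => [|s]; first exact: countableP.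
  have [mX _ _] := antX; have [Ss|nSs] := pselect (S s).
    rewrite (_ : [set t | _] = [set t | X n t = s]) //.
    by apply/seteqP; split=> t [].
  by rewrite (_ : [set t | _] = set0) //; apply/seteqP; split=> t [].
by apply/seteqP; split=> [t St|t [s _ [/= -> //]]]; exists (X n t).
Qed.

Definition past n (x : nat -> seq (edge G)) : set T :=
  [set t | forall m, (m < n)%N -> X m t = x m].

Lemma measurable_past n x : measurable (past n x).
Proof.
rewrite (_ : past n x = \bigcap_(m in [set m | (m < n)%N])
    [set t | [set x m] (X m t)]).
  by apply: bigcap_measurableType => m _; exact: measurable_walk.
by apply/seteqP; split.
Qed.

Lemma ant_weight_gt0 n x (e : edge G) : 0 < ant_weight R x n e.
Proof. by elim: n => [|n IHn] /=; rewrite ?ltr_wpDr. Qed.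

Section Harmonic.
Variables (n : nat) (x : nat -> seq (edge G)) (e0 : edge G).
(** [phi u] is meant to be the probability of crossing [e0] from [u]. Harmonicity is asked on
    [good], a set that the walk cannot leave before crossing [e0]. *)
Variables (phi : vertex G -> R) (good : pred (vertex G)).
Let w := ant_weight R x n.
Hypothesis phi01 : forall u, 0 <= phi u <= 1.
Hypothesis phi_food : phi (food G) = 0.
Hypothesis good_nest : good (nest G).
Hypothesis good_step : forall u e, good u -> u != food G -> incident e u ->
  e != e0 -> good (opposite u e).
Hypothesis no_trap : forall u, u != food G -> exists e, incident e u.
Hypothesis phi_harmonic : forall u, good u -> u != food G ->
  \sum_e step_prob w u e * (if e == e0 then 1 else phi (opposite u e)) = phi u.

Let Phi s := if e0 \in s then 1 else phi (walk_end (nest G) s).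

Let ev s (S : set (seq (edge G))) : set T :=
  past n x `&` [set t | ([set r | prefix s r] `&` S) (X n t)].

Let mev s S : measurable (ev s S).
Proof. by apply: measurableI; [exact: measurable_past|exact: measurable_walk]. Qed.

Let sum_step_prob u : u != food G -> \sum_e step_prob w u e = 1.
Proof.
move=> /no_trap[e eu]; rewrite /step_prob -big_mkcond /= -mulr_suml divff //.
rewrite gt_eqF // (bigD1 e) //= ltr_pwDl ?ant_weight_gt0 //.
by apply: sumr_ge0 => e' _; exact/ltW/ant_weight_gt0.
Qed.

Let ev_step s e : running_walk (nest G) s ->
  pr P (ev (rcons s e) setT) =
  pr P (ev s setT) * step_prob w (walk_end (nest G) s) e.
Proof.
have evE r : ev r setT = [set t | (forall m, (m < n)%N -> X m t = x m) /\
                    prefix r (X n t)].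
  by apply/seteqP; split=> t; [case=> ? []|case].
have [_ _ H] := antX; move=> /(H n x s e); rewrite -!evE => /(congr1 fine).
by rewrite /pr fineM // fin_num_measure.
Qed.

Let ev_split s S : running_walk (nest G) s ->
  pr P (ev s S) = \sum_e pr P (ev (rcons s e) S).
Proof.
move=> rs; rewrite (pr_split P (xi := fun t => nth e0 (X n t) (size s))) //; last first.
  by move=> e; exact: (measurable_walk n [set r | nth e0 r (size s) = e]).
apply: eq_bigr => e _; apply: pr_ae_eq => //.
  apply: measurableI => //.
  exact: (measurable_walk n [set r | nth e0 r (size s) = e]).
have [_ /(_ n) stop _] := antX; apply: filterS stop => t stop.
split=> [[[pt [/= Hs St]] /= He]|[pt [/= Hs St]]].
  split=> //; split=> //=; rewrite (prefix_rcons_nth e0) Hs He eqxx andbT /=.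
  (* [X n t] ends at the food, so it cannot equal the running walk [s]: a next step exists. *)
  rewrite ltnNge; apply/negP => sX.
  have Xs : X n t = s.
    by case/prefixP: Hs sX => r ->; rewrite size_cat -{2}[size s]addn0 leq_add2l leqn0
      => /nilP ->; rewrite cats0.
  by move: stop; rewrite Xs (negPf (running_not_stopped rs)).
move: Hs; rewrite (prefix_rcons_nth e0) => /and3P[Hs _ /eqP He].
by split.
Qed.

Let has_e0 : set (seq (edge G)) := [set r : seq (edge G) | e0 \in r].

Let le_ev s S S' : S `<=` S' -> pr P (ev s S) <= pr P (ev s S').
Proof.
move=> SS; apply: le_pr => // t [pt [ps St]].
by split=> //; split=> //; exact: SS.
Qed.

(** [Phi] is averaged exactly at each step, is exact once the walk stops, and lies in [[0, 1]]; so
    the error comes only from walks with at least [L] further edges. *)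
Let crossing_approx L s : running_walk (nest G) s ->
  (e0 \in s) || good (walk_end (nest G) s) ->
  `|pr P (ev s has_e0) - pr P (ev s setT) * Phi s| <=
  pr P (ev s [set r | (size s + L <= size r)%N]).
Proof.
elim: L s => [|L IHL] s rs gs.
  have -> : pr P (ev s [set r | (size s + 0 <= size r)%N]) = pr P (ev s setT).
    congr pr; apply/seteqP; split=> t [pt [/= ps _]]; split=> //; split=> //=.
    by rewrite addn0; case/prefixP: ps => r ->; rewrite size_cat leq_addr.
  have h1 := @le_ev s has_e0 setT (@subsetT _ _).
  have h0 := pr_ge0 P (ev s has_e0).
  have Q0 := pr_ge0 P (ev s setT).
  have /andP[P0 P1] : 0 <= Phi s <= 1.
    by rewrite /Phi; case: ifP => _ //; rewrite ler01 lexx.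
  by rewrite ler_norml; apply/andP; split; nra.
set u := walk_end (nest G) s in gs *.
have uF : u != food G by exact: running_walk_end.
have PhiE : Phi s = \sum_e step_prob w u e * Phi (rcons s e).
  rewrite /Phi; case: ifPn gs => [es _|nes /= gu].
    rewrite -[LHS](sum_step_prob uF); apply: eq_bigr => e _.
    by rewrite mem_rcons inE es orbT mulr1.
  rewrite -/u -(phi_harmonic gu uF); apply: eq_bigr => e _.
  by rewrite mem_rcons inE (negPf nes) orbF eq_sym walk_end_rcons.
rewrite PhiE mulr_sumr (ev_split has_e0 rs).
rewrite (ev_split [set r | (size s + L.+1 <= size r)%N] rs) -sumrB.
apply: le_trans (ler_norm_sum _ _ _) _; apply: ler_sum => e _.
rewrite mulrA -ev_step //.
(* Three cases for the next edge: probability 0; arrival at the food, where the walk is over;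
   otherwise the induction hypothesis. *)
have [inc|ninc] := boolP (incident e u); last first.
  have Q0 : pr P (ev (rcons s e) setT) = 0.
    by rewrite ev_step // /step_prob (negPf ninc) mulr0.
  have := @le_ev (rcons s e) has_e0 setT (@subsetT _ _).
  rewrite Q0 mul0r subr0 => h.
  by rewrite ger0_norm ?pr_ge0 // (le_trans h) // pr_ge0.
have [opp|opp] := eqVneq (opposite u e) (food G).
  have st := stopped_walk_rcons rs inc opp.
  suff -> : pr P (ev (rcons s e) has_e0) =
      pr P (ev (rcons s e) setT) * Phi (rcons s e).
    by rewrite subrr normr0 pr_ge0.
  have [_ /(_ n) stop _] := antX.
  rewrite /Phi; case: ifPn => [es|nes].
    rewrite mulr1; apply: pr_ae_eq => //; apply: filterS stop => t stop.
    split=> -[pt [/= ps _]]; split=> //; split=> //=.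
    by rewrite /has_e0 /= (stopped_walk_prefix st stop ps).
  rewrite walk_end_rcons -/u opp phi_food mulr0.
  rewrite -(pr_set0 P); apply: pr_ae_eq => //; apply: filterS stop => t stop.
  split=> // -[pt [/= ps]]; rewrite /has_e0 /= (stopped_walk_prefix st stop ps).
  by rewrite (negPf nes).
rewrite addnS -addSn -(size_rcons s e); apply: IHL.
  exact: running_walk_rcons.
rewrite mem_rcons inE walk_end_rcons -/u.
case/orP: gs => [->|gu]; first by rewrite orbT.
by have [//|ee] := eqVneq e0 e; rewrite good_step ?orbT // eq_sym.
Qed.

(** A walk is a finite sequence, so the events of length at least [L] decrease to the empty set and
    the error of [crossing_approx] vanishes. *)
Lemma pr_crossing :
  pr P (past n x `&` [set t | e0 \in X n t]) = pr P (past n x) * phi (nest G).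
Proof.
pose F L := ev [::] [set r | (L <= size r)%N].
have F0 : \bigcap_L F L = set0.
  apply/seteqP; split=> // t /(_ (size (X n t)).+1 I)[_ [_ /=]].
  by rewrite ltnn.
have cvgF := @nonincreasing_cvg_mu _ _ _ P F.
have {cvgF}: (P \o F) L @[L --> \oo] --> P (\bigcap_L F L).
  apply: cvgF.
  - by rewrite ltey_eq fin_num_measure //; exact: mev.
  - by move=> L; exact: mev.
  - by apply: bigcap_measurableType => L _; exact: mev.
  - move=> i j ij; apply/subsetPset => t [pt [ps /= Hj]].
    by split=> //; split=> //=; exact: leq_trans Hj.
rewrite F0 measure0 => /fine_cvg cvgF.
have noneE S : ev [::] S = past n x `&` [set t | S (X n t)].
  apply/seteqP; split=> t [pt]; first by case.
  by move=> St; split=> //; split=> //=; exact: prefix0s.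
have noneT : ev [::] setT = past n x.
  by rewrite noneE; apply/seteqP; split=> t; [case|].
have approx L : `|pr P (past n x `&` [set t | e0 \in X n t]) -
    pr P (past n x) * phi (nest G)| <= fine ((P \o F) L).
  have rn : running_walk (nest G) [::] by rewrite /= nest_neq_food.
  have := @crossing_approx L [::] rn; rewrite /= good_nest => /(_ isT).
  by rewrite noneT noneE.
apply/eqP; rewrite -subr_eq0 -normr_le0.
by apply: (cvgr_to_ge cvgF); apply: nearW => L; exact: approx.
Qed.

End Harmonic.

(** The weights depend on the past only through the traces, which take finitely many values, as the
    tree requires. *)
Definition trace n t : {set edge G} := [set e in X n t].

Fixpoint trace_weight (g : seq {set edge G}) e : R :=
  if g is a :: g' then trace_weight g' e + (e \in a)%:R else 1.

Lemma measurable_trace n a : measurable [set t | trace n t = a].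
Proof. exact: (measurable_walk n [set r : seq (edge G) | [set e in r] = a]). Qed.

Lemma ant_weight_trace t n e :
  ant_weight R (fun m => X m t) n e = trace_weight (history trace n t) e.
Proof. by elim: n => //= n ->; rewrite inE. Qed.

Lemma ant_weight_past n x t : past n x t ->
  ant_weight R x n = ant_weight R (fun m => X m t) n.
Proof.
move=> pt; apply/funext => e; elim: n pt => //= n IHn pt.
by rewrite IHn ?pt // => m mn; rewrite pt // ltnW.
Qed.

(** Passes from conditioning on the full walks to conditioning on their traces: the weights, hence
    [pi], are constant on a cylinder, so [pr_mixture] applies. *)
Lemma pr_trace_crossing e0 (pi : (edge G -> R) -> R) :
  (forall w, (forall e, 0 < w e) -> 0 <= pi w) ->
  (forall n x, pr P (past n x `&` [set t | e0 \in X n t]) =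
               pr P (past n x) * pi (ant_weight R x n)) ->
  forall g, \sum_a pr P (cylinder trace (a :: g)) * (e0 \in a)%:R =
            pr P (cylinder trace g) * pi (trace_weight g).
Proof.
move=> pi0 Hpi g; set n := size g.
have mE : measurable [set t | e0 \in X n t].
  exact: (measurable_walk n [set r : seq (edge G) | e0 \in r]).
have mC := measurable_cylinder measurable_trace.
have -> : \sum_a pr P (cylinder trace (a :: g)) * (e0 \in a)%:R =
    pr P (cylinder trace g `&` [set t | e0 \in X n t]).
  rewrite (pr_split P (measurable_trace n)); last exact: measurableI.
  apply: eq_bigr => a _; rewrite cylinder_cons.
  have [ea|nea] := boolP (e0 \in a).
    rewrite mulr1; congr pr; apply/seteqP; split=> t [Ct /= ta].
      by split=> //; split=> //=; move: ea; rewrite -ta inE.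
    by split=> //; case: Ct.
  rewrite mulr0 -(pr_set0 P); congr pr; apply/seteqP; split=> // t [[_ /= et] /= ta].
  by move: nea; rewrite -ta inE et.
have wg0 h e : 0 < trace_weight h e.
  by elim: h => [|a h IHh] /=; rewrite ?ltr_wpDr.
pose Z t := [seq X m t | m <- iota 0 n].
have ZE y t : Z t = y <-> size y = n /\ past n (nth [::] y) t.
  split=> [<-|[sy py]].
    split; first by rewrite size_map size_iota.
    move=> m mn; rewrite (nth_map 0%N) ?size_iota // nth_iota //.
  apply: (@eq_from_nth _ [::]); first by rewrite size_map size_iota.
  move=> m; rewrite size_map size_iota => mn.
  by rewrite (nth_map 0%N) ?size_iota // nth_iota // py.
have mZ y : measurable [set t | Z t = y].
  have [sy|sy] := pselect (size y = n); last first.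
    by rewrite (_ : [set t | _] = set0) //; apply/seteqP; split=> // t /= /ZE[].
  rewrite (_ : [set t | _] = past n (nth [::] y)); first exact: measurable_past.
  by apply/seteqP; split=> t; [case/ZE|move=> pt; apply/ZE].
apply: (pr_mixture (Z := Z)) => //; first exact: pi0.
move=> y.
have [[t0 [Ct0 Zt0]]|none] :=
  pselect (exists t, cylinder trace g t /\ Z t = y); last first.
  have -> : cylinder trace g `&` [set t | Z t = y] = set0.
    by apply/seteqP; split=> // t [Ct Zt]; apply: none; exists t.
  by rewrite set0I pr_set0 mul0r.
have [sy pt0] := (ZE y t0).1 Zt0.
have trace_past t : past n (nth [::] y) t -> history trace n t = g.
  move=> pt; rewrite -Ct0 -/n.
  suff H k : (k <= n)%N -> history trace k t = history trace k t0 by exact: H.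
  elim: k => [|k IHk] //= kn; rewrite IHk; last exact: ltnW.
  by rewrite /trace pt // pt0.
have -> : cylinder trace g `&` [set t | Z t = y] = past n (nth [::] y).
  apply/seteqP; split=> t; first by case=> _ /ZE[].
  by move=> pt; split; [exact: trace_past|apply/ZE].
rewrite Hpi (ant_weight_past pt0); congr (_ * pi _).
by apply/funext => e; rewrite ant_weight_trace trace_past.
Qed.

End Crossing.

(** * Logarithm of a weight *)

(** A crossing adds [1 / W - ln (1 + 1 / W)], which is nonnegative and at most
    [1 / W - 1 / (W + 1)]; these bounds telescope. *)
Lemma log_sum_cvg (R : realType) (xi : nat -> bool) (W : nat -> R) :
  W 0%N = 1 -> (forall n, W n.+1 = W n + (xi n)%:R) ->
  cvgn (fun n => \sum_(m < n) (xi m)%:R / W m - ln (W n)).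
Proof.
move=> W0 WS.
have W1 n : 1 <= W n by elim: n => [|n IHn]; rewrite ?W0 // WS ler_wpDr.
have Wp n : 0 < W n by exact: lt_le_trans (W1 n).
have stepE n : W n.+1 = W n * (1 + (xi n)%:R / W n).
  by rewrite WS mulrDr mulr1 mulrCA mulfV ?mulr1 // gt_eqF.
have fac n : 1 <= 1 + (xi n)%:R / W n.
  by rewrite lerDl divr_ge0 ?ler0n // ltW.
have lnS n : ln (W n.+1) = ln (W n) + ln (1 + (xi n)%:R / W n).
  by rewrite stepE lnM ?posrE //; exact: lt_le_trans (fac n).
apply: nondecreasing_is_cvgn.
  apply/nondecreasing_seqP => n; rewrite big_ord_recr /= lnS.
  have : ln (1 + (xi n)%:R / W n) <= (xi n)%:R / W n.
    by apply: ln1Dx_le; rewrite divr_ge0 ?ler0n // ltW.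
  move: (_ / _) => z; lra.
exists 1 => _ [n _ <-].
suff : \sum_(m < n) (xi m)%:R / W m - ln (W n) <= 1 - (W n)^-1.
  by have := invr_gt0 (W n); rewrite Wp; lra.
elim: n => [|n IHn]; first by rewrite big_ord0 W0 ln1 invr1; lra.
rewrite big_ord_recr /= lnS.
suff : (xi n)%:R / W n - ln (1 + (xi n)%:R / W n) <= (W n)^-1 - (W n.+1)^-1.
  by move: IHn; set a := _ / _; lra.
rewrite WS; case: (xi n); last by rewrite mul0r !addr0 ln1 !subrr.
have Wp1 : 0 < W n + 1 by rewrite addr_gt0.
rewrite mul1r lerB // -lerN2 -lnV ?posrE ?addr_gt0 ?invr_gt0 //.
have -> : (1 + (W n)^-1)^-1 = 1 + - (W n + 1)^-1.
  by field; rewrite !gt_eqF ?Wp1 // addrC.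
apply: le_ln1Dx; rewrite ltrN2 invf_lt1 //; have := Wp n; lra.
Qed.

Section LogWeight.
Context (R : realType) (G : ant_graph) d (T : measurableType d).
Context (P : probability T R) (X : nat -> T -> seq (edge G)).
Hypothesis antX : is_ant_process P X.
Variables (e0 : edge G) (pi : (edge G -> R) -> R).
Hypothesis pi01 : forall w, (forall e, 0 < w e) -> 0 <= pi w <= 1.
Hypothesis pi_crossing : forall n x,
  pr P (past X n x `&` [set t | e0 \in X n t]) =
  pr P (past X n x) * pi (ant_weight R x n).

Let W (g : seq {set edge G}) : R := trace_weight R g e0.

Fixpoint noise (g : seq {set edge G}) : R :=
  if g is a :: g' then
    noise g' + ((e0 \in a)%:R - pi (trace_weight R g')) / trace_weight R g' e0
  else 0.

Lemma trace_weight_ge1 (g : seq {set edge G}) (e : edge G) : 1 <= trace_weight R g e.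
Proof. by elim: g => [|a g IHg] //=; rewrite ler_wpDr. Qed.

Lemma noise_cvg : {ae P, forall t, cvgn (fun n => noise (history (trace X) n t))}.
Proof.
have W1 g : 1 <= W g by exact: trace_weight_ge1.
have W0 g : 0 < W g by exact: lt_le_trans (W1 g).
have pig g : 0 <= pi (trace_weight R g) <= 1.
  by apply: pi01 => e; exact: lt_le_trans (trace_weight_ge1 _ _).
have pi_ge0 w : (forall e, 0 < w e) -> 0 <= pi w by move=> /pi01/andP[].
have H := pr_trace_crossing antX pi_ge0 pi_crossing.
have S g := pr_cylinder_split P (measurable_trace antX) g.
(* Each crossing makes 2 / W decrease by 2 / (W (W + 1)) >= 1 / W^2. *)
apply: (tree_martingale_cvg (measurable_trace antX) (A := fun g => 2 / W g)).
- by move=> g; rewrite divr_ge0 // ltW.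
- move=> a g; rewrite ler_pM2l // lef_pV2 ?posrE // /W /= lerDl ler0n //.
- move=> g /=; set v := pi _.
  rewrite (eq_bigr (fun a => (pr P (cylinder (trace X) (a :: g)) *
     (e0 \in a)%:R - pr P (cylinder (trace X) (a :: g)) * v) / W g)); last first.
    by move=> a _; rewrite -/(W g); ring.
  by rewrite -mulr_suml sumrB H -mulr_suml -S subrr mul0r.
- move=> g /=; set v := pi _; rewrite -/(W g).
  have /andP[v0 v1] : 0 <= v <= 1 by exact: pig.
  have Wg := W0 g.
  have E1 : \sum_a pr P (cylinder (trace X) (a :: g)) *
      (noise g + ((e0 \in a)%:R - v) / W g - noise g) ^+ 2 =
      pr P (cylinder (trace X) g) * v * ((1 - v) / W g ^+ 2).
    rewrite (eq_bigr (fun a => pr P (cylinder (trace X) (a :: g)) *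
      (e0 \in a)%:R * ((1 - 2 * v) / W g ^+ 2) +
      pr P (cylinder (trace X) (a :: g)) * (v ^+ 2 / W g ^+ 2))); last first.
      by move=> a _; case: (e0 \in a) => /=; field; rewrite gt_eqF.
    rewrite big_split /= -!mulr_suml H -S -/v; ring.
  have E2 : \sum_a pr P (cylinder (trace X) (a :: g)) *
      (2 / W g - 2 / W (a :: g)) =
      pr P (cylinder (trace X) g) * v * (2 / (W g * (W g + 1))).
    rewrite -[_ * v]H mulr_suml; apply: eq_bigr => a _; rewrite /W /= -/(W g).
    have W10 : W g + 1 != 0 by rewrite gt_eqF // addr_gt0.
    by case: (e0 \in a) => /=; field; rewrite ?W10 ?addr0 gt_eqF.
  (* There remains [(1 - v) * (W + 1) <= 2 * W], true as [W >= 1]. *)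
  rewrite E1 E2 ler_wpM2l ?mulr_ge0 ?pr_ge0 //.
  rewrite ler_pdivrMr ?exprn_gt0 // mulrAC ler_pdivlMr ?mulr_gt0 ?addr_gt0 //.
  by have := W1 g; nra.
Qed.

(** Replacing [pi] by the indicator of a crossing costs [noise], and replacing the resulting sum by
    [ln W] costs the remainder of [log_sum_cvg]; both converge. *)
Lemma log_weight_cvg : {ae P, forall t,
  let w n := ant_weight R (fun m => X m t) n in
  cvgn (fun n => ln (w n e0) - \sum_(m < n) pi (w m) / w m e0)}.
Proof.
apply: filterS noise_cvg => t Ht /=.
set w := ant_weight R (fun m => X m t).
have noiseE n : noise (history (trace X) n t) =
    \sum_(m < n) (e0 \in X m t)%:R / w m e0 - \sum_(m < n) pi (w m) / w m e0.
  have wE m : trace_weight R (history (trace X) m t) = w m.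
    by apply/funext => e; rewrite -(@ant_weight_trace R).
  elim: n => [|n IHn] /=; first by rewrite !big_ord0 subrr.
  by rewrite !big_ord_recr /= IHn wE inE; ring.
have HW := @log_sum_cvg R (fun m => e0 \in X m t) (fun m => w m e0) erefl
  (fun=> erefl).
rewrite (_ : (fun n => _) = (fun n => noise (history (trace X) n t) -
    (\sum_(m < n) (e0 \in X m t)%:R / w m e0 - ln (w n e0)))).
  exact: is_cvgB.
by apply/funext => n; rewrite noiseE; ring.
Qed.

End LogWeight.

(** * The path graph *)

Section PathGraphWalk.
Variables (R : realType) (p q : nat).
Hypotheses (p2 : (2 <= p)%N) (q2 : (2 <= q)%N).
Local Notation G := (path_graph p q).

(* The side [true] is the path with p edges; the edges of each side are numbered
   from 0, and [pedge s i] joins [vert s i] and [vert s i.+1]. *)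
Definition len (s : bool) : nat := if s then p else q.

Definition vert (s : bool) (i : nat) : vertex G :=
  if s then a_vertex p q i else b_vertex p q i.

Definition pedge (s : bool) (i : nat) : edge G :=
  if s then inl (insubd (Ordinal (ltnW p2)) i)
  else inr (insubd (Ordinal (ltnW q2)) i).

(** N and F lie on both sides and get [true] by convention. *)
Definition pos (u : vertex G) : bool * nat :=
  match u with
  | inl false => (true, 0%N)
  | inl true => (true, p)
  | inr (inl o) => (true, o.+1)
  | inr (inr o) => (false, o.+1)
  end.

Lemma len_ge2 s : (2 <= len s)%N. Proof. by case: s. Qed.

Lemma vert0 s : vert s 0 = nest G. Proof. by case: s. Qed.

Lemma vert_len s : vert s (len s) = food G.
Proof.
rewrite /vert /len; case: s.
  by case: p p2 => // p' _ /=; rewrite insubF ?ltnn.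
by case: q q2 => // q' _ /=; rewrite insubF ?ltnn.
Qed.

Lemma pos_vert s i : (0 < i < len s)%N -> pos (vert s i) = (s, i).
Proof.
by case: i => // i; rewrite /vert /len; case: s => /= H; rewrite insubT ?ltn_predRL.
Qed.

Lemma vert_neq_food s i : (i < len s)%N -> vert s i != food G.
Proof.
case: i => [|i] il; first by rewrite vert0 nest_neq_food.
apply/eqP => H; have := @pos_vert s i.+1 il; rewrite H /=.
by case=> sE; move: il; rewrite -sE /= => /[swap] <-; rewrite ltnn.
Qed.

Lemma vertP u : u != food G -> exists s i, (i < len s)%N /\ u = vert s i.
Proof.
case: u => [[|] | [ o | o ]]; rewrite ?eqxx // => _.
- by exists true, 0%N; split; [exact: ltnW|].
- exists true, o.+1; split; first by have := ltn_ord o; rewrite /len ltn_predRL.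
  by rewrite /vert /= valK.
- exists false, o.+1; split; first by have := ltn_ord o; rewrite /len ltn_predRL.
  by rewrite /vert /= valK.
Qed.

Lemma vert_inj s i j : (i <= len s)%N -> (j <= len s)%N ->
  vert s i = vert s j -> i = j.
Proof.
wlog ij : i j / (i < j)%N.
  move=> H il jl E; case: (ltngtP i j) => // ij; first exact: H.
  by apply/esym/H.
move=> il jl E; exfalso.
have il' : (i < len s)%N by exact: leq_trans jl.
move: jl; rewrite leq_eqVlt => /orP[/eqP jl|jl].
  by have := vert_neq_food il'; rewrite E jl vert_len eqxx.
have Pj := @pos_vert s j (introT andP (conj (leq_ltn_trans (leq0n i) ij) jl)).
case: i ij il' E {il} => [|i] ij il E.
  by move: Pj; rewrite -E vert0 => -[_ j0]; rewrite -j0 in ij.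
have := @pos_vert s i.+1 il; rewrite E Pj => -[ji].
by rewrite ji ltnn in ij.
Qed.

Lemma vert_side s s' i j : (0 < i < len s)%N -> (j <= len s')%N ->
  vert s i = vert s' j -> s = s'.
Proof.
move=> /andP[i0 il]; rewrite leq_eqVlt => /orP[/eqP jl|jl] E.
  by have := vert_neq_food il; rewrite E jl vert_len eqxx.
have Pi := @pos_vert s i (introT andP (conj i0 il)).
case: j jl E => [|j] jl E; last first.
  by have := @pos_vert s' j.+1 jl; rewrite -E Pi => -[].
by move: Pi; rewrite E vert0 => -[_ i0']; rewrite -i0' in i0.
Qed.

Lemma ends_pedge s i : (i < len s)%N -> ends (pedge s i) = (vert s i, vert s i.+1).
Proof. by case: s => il; rewrite /= ?insubdK. Qed.

Lemma pedgeP e : exists s i, (i < len s)%N /\ e = pedge s i.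
Proof.
case: e => o; first by exists true, o; split=> //; rewrite /pedge valKd.
by exists false, o; split=> //; rewrite /pedge valKd.
Qed.

Lemma pedge_inj s s' i j : (i < len s)%N -> (j < len s')%N ->
  pedge s i = pedge s' j -> s = s' /\ i = j.
Proof.
case: s s' => [] [] //= il jl [] /(congr1 val); rewrite !val_insubd il jl.
  by split.
by split.
Qed.

Lemma incident_pedge s i u : (i < len s)%N ->
  incident (pedge s i) u = (u == vert s i) || (u == vert s i.+1).
Proof. by move=> il; rewrite /incident ends_pedge. Qed.

Lemma opposite_next s i : (i < len s)%N -> opposite (vert s i) (pedge s i) = vert s i.+1.
Proof. by move=> il; rewrite /opposite ends_pedge // eqxx. Qed.

Lemma opposite_prev s i : (i < len s)%N -> opposite (vert s i.+1) (pedge s i) = vert s i.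
Proof.
by move=> il; rewrite /opposite ends_pedge //=; case: eqP.
Qed.

Lemma incident_inner s i e : (0 < i < len s)%N ->
  incident e (vert s i) = (e == pedge s i.-1) || (e == pedge s i).
Proof.
move=> /andP[i0 il]; have [s' [j [jl ->]]] := pedgeP e.
have il' : (i.-1 < len s)%N by exact: leq_ltn_trans (leq_pred i) il.
rewrite incident_pedge //; apply/idP/idP.
  case/orP=> /eqP E.
    have ss := @vert_side s s' i j ltac:(by rewrite i0 il) (ltnW jl) E.
    by subst s'; rewrite (vert_inj (ltnW il) (ltnW jl) E) eqxx orbT.
  have ss := @vert_side s s' i j.+1 ltac:(by rewrite i0 il) jl E.
  by subst s'; rewrite (vert_inj (ltnW il) jl E) eqxx.
case/orP=> /eqP /pedge_inj[]// -> ->; last by rewrite eqxx.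
by rewrite prednK // eqxx orbT.
Qed.

Lemma incident_nest s e :
  incident e (nest G) = (e == pedge s 0) || (e == pedge (~~ s) 0).
Proof.
have l0 s' : (0 < len s')%N by exact: ltnW (len_ge2 s').
have [s' [j [jl ->]]] := pedgeP e.
rewrite incident_pedge // -{1}(vert0 s') -(vert0 s'); apply/idP/idP.
  case/orP=> /eqP /vert_inj; rewrite ?(ltnW jl) // => /(_ isT).
    by move=> /(_ isT) <-; case: s s' {jl} => -[]; rewrite eqxx ?orbT.
  by move=> /(_ jl).
by case/orP=> /eqP /pedge_inj[]// _ ->; rewrite eqxx.
Qed.

(** Vertices of the path graph have degree two, so harmonicity is a balance of two currents with
    conductances [w]. *)
Lemma two_edges_mean (w : edge G -> R) (c : edge G -> R) u e1 e2 v :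
  (forall e, 0 < w e) ->
  (forall e, incident e u = (e == e1) || (e == e2)) -> e1 != e2 ->
  w e1 * (c e1 - v) + w e2 * (c e2 - v) = 0 ->
  \sum_e step_prob w u e * c e = v.
Proof.
move=> w0 inc e12 H.
have two (F : edge G -> R) : \sum_(e | incident e u) F e = F e1 + F e2.
  rewrite (bigD1 e1) ?inc ?eqxx //=; congr (_ + _).
  rewrite (big_pred1 e2) // => e; rewrite inc /=.
  by have [->|ne] := eqVneq e e1; rewrite /= ?andbT // (negPf e12).
rewrite (bigID (fun e => incident e u)) /= [X in _ + X]big1 ?addr0; last first.
  by move=> e /negPf ne; rewrite /step_prob ne mul0r.
rewrite two /step_prob !inc !eqxx orbT /= !two.
have w12 : w e1 + w e2 != 0 by rewrite gt_eqF // addr_gt0.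
apply: (mulfI w12); transitivity (w e1 * c e1 + w e2 * c e2); first by field.
by move: H; lra.
Qed.

Definition path_resistance (w : edge G -> R) s k : R :=
  \sum_(i < k) (w (pedge s i))^-1.

(** Gambler's ruin on the segment that joins the far end of [pedge s k] to F through N: the two
    exits have probabilities inversely proportional to their resistances from N. *)
Definition path_crossing s k (w : edge G -> R) : R :=
  path_resistance w (~~ s) (len (~~ s)) /
  (path_resistance w s k.+1 + path_resistance w (~~ s) (len (~~ s))).

Section Potential.
Variables (w : edge G -> R) (s : bool) (k : nat).
Hypotheses (w0 : forall e, 0 < w e) (kl : (k < len s)%N).

Let t := ~~ s.
Let rho := path_resistance w.
Let D := rho s k.+1 + rho t (len t).

Lemma path_resistance_ge0 s' i : 0 <= rho s' i.
Proof. by apply: sumr_ge0 => j _; rewrite invr_ge0 ltW. Qed.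

Lemma path_resistanceS s' i : rho s' i.+1 = rho s' i + (w (pedge s' i))^-1.
Proof. exact: big_ord_recr. Qed.

Lemma path_resistance_le s' i j : (i <= j)%N -> rho s' i <= rho s' j.
Proof.
move=> /subnKC <-; elim: (j - i)%N => [|m IHm]; first by rewrite addn0.
by rewrite addnS path_resistanceS (le_trans IHm) // lerDl invr_ge0 ltW.
Qed.

Let D0 : 0 < D.
Proof.
rewrite ltr_pwDl ?path_resistance_ge0 // path_resistanceS.
by rewrite ltr_wpDl ?path_resistance_ge0 // invr_gt0.
Qed.

(* The probability to cross [pedge s k] before the food. Its value beyond this
   edge is irrelevant, and capped to stay in [0, 1]. *)
Definition potential (u : vertex G) : R :=
  if u == food G then 0 else
  let: (s', i) := pos u in
  if (i == 0)%N then rho t (len t) / D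
  else if s' == s then Num.min 1 ((rho t (len t) + rho s i) / D)
  else (rho t (len t) - rho t i) / D.

(** The vertices that can be visited before crossing [pedge s k]; F is among them through the other
    path. *)
Definition uncrossed (u : vertex G) : bool :=
  (u == food G) || let: (s', i) := pos u in (s' == s) ==> (i <= k)%N.

Lemma potential_same i : (i <= k)%N ->
  potential (vert s i) = (rho t (len t) + rho s i) / D.
Proof.
move=> ik; have il := leq_ltn_trans ik kl.
rewrite /potential (negPf (vert_neq_food il)).
case: i ik il => [|i] ik il.
  by rewrite vert0 /= [rho s 0]big_ord0 addr0.
rewrite pos_vert // eqxx /= min_r // ler_pdivrMr // mul1r addrC lerD2r.
exact/path_resistance_le/leqW.
Qed.

Lemma potential_other i : (i <= len t)%N ->
  potential (vert t i) = (rho t (len t) - rho t i) / D.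
Proof.
rewrite leq_eqVlt => /orP[/eqP->|il].
  by rewrite vert_len /potential eqxx subrr mul0r.
rewrite /potential (negPf (vert_neq_food il)).
case: i il => [|i] il; first by rewrite vert0 /= [rho t 0]big_ord0 subr0.
by rewrite pos_vert //= /t; case: (s).
Qed.

Lemma potential01 u : 0 <= potential u <= 1.
Proof.
have [->|uF] := eqVneq u (food G); first by rewrite /potential eqxx lexx ler01.
have [s' [i [il ->]]] := vertP uF.
have rD : rho t (len t) / D <= 1.
  by rewrite ler_pdivrMr // mul1r /D lerDr path_resistance_ge0.
have [|ss] := eqVneq s' t.
  move=> ss; subst s'; rewrite potential_other ?(ltnW il) //; apply/andP; split.
    by rewrite divr_ge0 ?(ltW D0) // subr_ge0 path_resistance_le // ltnW.
  apply: le_trans rD; rewrite ler_pM2r ?invr_gt0 //.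
  by rewrite gerBl path_resistance_ge0.
have {}ss : s' = s by move: ss; rewrite /t; case: (s'); case: (s).
subst s'; rewrite /potential (negPf (vert_neq_food il)).
case: i il => [|i] il.
  by rewrite vert0 /= rD divr_ge0 ?path_resistance_ge0 // ltW.
rewrite pos_vert //= eqxx ge_min lexx andbT le_min ler01 /=.
by rewrite divr_ge0 ?addr_ge0 ?path_resistance_ge0 // ltW.
Qed.

Lemma uncrossed_same i : (i < len s)%N -> uncrossed (vert s i) = (i <= k)%N.
Proof.
move=> il; rewrite /uncrossed (negPf (vert_neq_food il)) /=.
case: i il => [|i] il; first by rewrite vert0 /= implybT.
by rewrite pos_vert // eqxx.
Qed.

Lemma uncrossed_other i : (i <= len t)%N -> uncrossed (vert t i).
Proof.
rewrite leq_eqVlt => /orP[/eqP->|il]; first by rewrite vert_len /uncrossed eqxx.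
rewrite /uncrossed; case: i il => [|i] il; first by rewrite vert0 /= implybT.
by rewrite pos_vert // /t; case: (s); rewrite orbT.
Qed.

Lemma uncrossedP u : uncrossed u -> u != food G ->
  (exists2 i, (i <= k)%N & u = vert s i) \/
  (exists2 i, (0 < i < len t)%N & u = vert t i).
Proof.
move=> gu uF; have [s' [i [il uE]]] := vertP uF; subst u.
have [ss|ss] := eqVneq s' s; first by subst s'; left; exists i; rewrite -?uncrossed_same.
have {}ss : s' = t by move: ss; rewrite /t; case: (s'); case: (s).
subst s'; case: i il {gu uF} => [|i] il; last by right; exists i.+1.
by left; exists 0%N; rewrite ?vert0.
Qed.

Lemma uncrossed_step u e : uncrossed u -> u != food G -> incident e u ->
  e != pedge s k -> uncrossed (opposite u e).
Proof.
have l0 s' : (0 < len s')%N by exact: ltnW (len_ge2 s').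
move=> gu uF; have [[[|i] ik ->] | [[|i] // il ->]] := uncrossedP gu uF.
- rewrite vert0 (incident_nest s) => /orP[] /eqP -> ne.
    rewrite -(vert0 s) opposite_next // uncrossed_same ?len_ge2 // lt0n.
    by apply: contraNneq ne => ->.
  by rewrite -(vert0 t) opposite_next // uncrossed_other // len_ge2.
- have il := leq_ltn_trans ik kl.
  rewrite incident_inner // => /orP[] /eqP -> ne /=.
    by rewrite opposite_prev ?uncrossed_same ?(ltnW ik) // ltnW.
  rewrite opposite_next // uncrossed_same.
    by rewrite ltn_neqAle ik andbT; apply: contraNneq ne => ->.
  have : (i.+1 != k) by apply: contraNneq ne => ->.
  by move: ik kl; lia.
- rewrite incident_inner // => /orP[] /eqP -> _ /=.
    by rewrite opposite_prev ?uncrossed_other ?(ltnW (ltnW il)) // ltnW.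
  by rewrite opposite_next // uncrossed_other.
Qed.

(** Along the segment the potential is affine in the resistance, so the same current flows through
    consecutive edges. *)
Lemma potential_harmonic u : uncrossed u -> u != food G ->
  \sum_e step_prob w u e *
    (if e == pedge s k then 1 else potential (opposite u e)) = potential u.
Proof.
have l0 s' : (0 < len s')%N by exact: ltnW (len_ge2 s').
have DN : D != 0 by rewrite gt_eqF.
have wN e : w e != 0 by rewrite gt_eqF.
have st : s != t by rewrite /t; case: (s).
move=> gu uF.
(* The value 1 given to a crossing of [pedge s k] is the affine formula at [k.+1], even when that
   vertex is F, where [potential] is 0. *)
have next i : (i <= k)%N -> (if pedge s i == pedge s k then 1 else
    potential (opposite (vert s i) (pedge s i))) = (rho t (len t) + rho s i.+1) / D.
  move=> ik; have il := leq_ltn_trans ik kl; case: eqP => [/pedge_inj[]// _ ->|ne].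
    by rewrite addrC divff.
  rewrite opposite_next // potential_same // ltn_neqAle ik andbT.
  by apply/eqP => ik'; apply: ne; rewrite ik'.
have other i : (i < len t)%N -> pedge t i == pedge s k = false.
  by move=> il; apply/negP => /eqP /pedge_inj[]// /eqP; rewrite eq_sym (negPf st).
have [[[|i] ik uE] | [[|i] // il uE]] := uncrossedP gu uF; subst u.
- apply: (@two_edges_mean _ _ _ (pedge s 0) (pedge t 0)) => //.
  + by move=> e; rewrite vert0 (incident_nest s).
  + by apply/negP => /eqP /pedge_inj[]// /eqP; rewrite (negPf st).
  rewrite next // other // potential_same //.
  rewrite vert0 -(vert0 t) opposite_next ?l0 // potential_other ?l0 //.
  rewrite !path_resistanceS [rho s 0]big_ord0 [rho t 0]big_ord0.
  by move: (wN (pedge s 0)) (wN (pedge t 0)) => h1 h2; field; rewrite ?DN ?h1 ?h2.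
- have il := leq_ltn_trans ik kl.
  apply: (@two_edges_mean _ _ _ (pedge s i) (pedge s i.+1)) => //.
  + by move=> e; rewrite incident_inner.
  + by apply/negP => /eqP /pedge_inj[]//; [exact: ltnW|lia].
  rewrite next // potential_same //; case: eqP => [/pedge_inj[]//|_].
  + exact: ltnW.
  + by move=> _ ik'; move: ik; rewrite ik' ltnn.
  rewrite opposite_prev ?potential_same ?(ltnW ik) //; last exact: ltnW.
  rewrite !path_resistanceS.
  by move: (wN (pedge s i)) (wN (pedge s i.+1)) => h1 h2; field; rewrite ?DN ?h1 ?h2.
- have /andP[_ il'] := il.
  apply: (@two_edges_mean _ _ _ (pedge t i) (pedge t i.+1)) => //.
  + by move=> e; rewrite incident_inner.
  + by apply/negP => /eqP /pedge_inj[]//; [exact: ltnW|lia].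
  rewrite !other ?(ltnW il') // opposite_next // opposite_prev ?(ltnW il') //.
  rewrite !potential_other // ?(ltnW il') // ?(ltnW (ltnW il')) //.
  rewrite !path_resistanceS.
  by move: (wN (pedge t i)) (wN (pedge t i.+1)) => h1 h2; field; rewrite ?DN ?h1 ?h2.
Qed.

Lemma potential_nest : potential (nest G) = path_crossing s k w.
Proof. by rewrite -(vert0 s) potential_same // [rho s 0]big_ord0 addr0. Qed.

End Potential.

Lemma path_crossing01 s k w : (k < len s)%N -> (forall e, 0 < w e) ->
  0 <= path_crossing s k w <= 1.
Proof. by move=> kl w0; rewrite -potential_nest // potential01. Qed.

Lemma path_no_trap (u : vertex G) : u != food G -> exists e, incident e u.
Proof.
move=> /vertP[s [i [il ->]]]; exists (pedge s i).
by rewrite incident_pedge // eqxx.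
Qed.

(** * The ant process on the path graph *)

Section PathProcess.
Context d (T : measurableType d) (P : probability T R).
Variable X : nat -> T -> seq (edge G).
Hypothesis antX : is_ant_process P X.

Lemma pr_path_crossing s k n x : (k < len s)%N ->
  pr P (past X n x `&` [set t | pedge s k \in X n t]) =
  pr P (past X n x) * path_crossing s k (ant_weight R x n).
Proof.
move=> kl; have w0 := @ant_weight_gt0 R G n x.
rewrite -(potential_nest w0 kl).
apply: (pr_crossing antX (good := uncrossed s k)).
- exact: potential01.
- by rewrite /potential eqxx.
- by rewrite -(vert0 s) uncrossed_same ?(leq_ltn_trans _ kl).
- by move=> u e; exact: uncrossed_step.
- exact: path_no_trap.
- by move=> u; exact: potential_harmonic.
Qed.

(** Dividing by [n.+1] keeps the rate in [(0, 1]] from [n = 0] on. *)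
Definition rate t s k n : R :=
  ant_weight R (fun m => X m t) n (pedge s k) / n.+1%:R.

Lemma rate01 t s k n : 0 < rate t s k n <= 1.
Proof.
rewrite /rate divr_gt0 ?ltr0n //= ?ant_weight_gt0 // ler_pdivrMr // mul1r.
elim: n => [|n IHn] //=; rewrite -[leRHS]natr1 lerD //.
by case: (_ \in _); rewrite ?ler01 ?lexx.
Qed.

Lemma rate_resistance t s k n : resistance (rate t s) k n =
  n.+1%:R * path_resistance (ant_weight R (fun m => X m t) n) s k.
Proof. by rewrite mulr_sumr; apply: eq_bigr => i _; rewrite /rate invf_div. Qed.

Lemma rate_driven s : {ae P, forall t,
  driven (len s) (rate t s) (resistance (rate t (~~ s)) (len (~~ s)))}.
Proof.
have H : {ae P, forall t k, (k < len s)%N ->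
    cvgn (fun n => ln (rate t s k n) - \sum_(m < n)
      drift (rate t s) (resistance (rate t (~~ s)) (len (~~ s))) k m / m.+1%:R)}.
  apply: ae_foralln => k; have [kl|kl] := ltnP k (len s); last first.
    by apply: aeW.
  have Hw := log_weight_cvg antX (fun w w0 => path_crossing01 kl w0)
    (fun n x => pr_path_crossing n x kl).
  apply: filterS Hw => t; set w := ant_weight R (fun m => X m t) => /= Hw _.
  (* An edge crossed by every walk would have weight [n.+1]: this gives the convergence of the
     harmonic sum minus [ln n.+1]. *)
  have Hh := @log_sum_cvg R (fun=> true) (fun n => n.+1%:R) erefl
    (fun n => esym (natr1 _)).
  rewrite (_ : (fun n => _) = (fun n => (ln (w n (pedge s k)) -
      \sum_(m < n) path_crossing s k (w m) / w m (pedge s k)) +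
      (\sum_(m < n) true%:R / m.+1%:R - ln n.+1%:R))); first exact: is_cvgD.
  apply/funext => n; rewrite /rate ln_div ?posrE ?ltr0n ?ant_weight_gt0 //.
  rewrite -/w.
  suff -> : \sum_(m < n)
      drift (rate t s) (resistance (rate t (~~ s)) (len (~~ s))) k m / m.+1%:R =
      \sum_(m < n) path_crossing s k (w m) / w m (pedge s k) -
      \sum_(m < n) true%:R / m.+1%:R by ring.
  rewrite -sumrB; apply: eq_bigr => m _.
  rewrite /drift !rate_resistance /rate -/w /path_crossing path_resistanceS.
  have wk : 0 < w m (pedge s k) by exact: ant_weight_gt0.
  have w0 e : 0 < w m e by exact: ant_weight_gt0.
  have r1 := path_resistance_ge0 w0 s k.
  have r2 := path_resistance_ge0 w0 (~~ s) (len (~~ s)).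
  move: r1 r2; set a := path_resistance _ _ _; set b := path_resistance _ _ _ => r1 r2.
  have m0 : m.+1%:R != 0 :> R by rewrite pnatr_eq0.
  move: wk; set c := w m _ => wk.
  have cN : c != 0 by rewrite gt_eqF.
  have D0 : 1 + (a + b) * c != 0.
    by rewrite gt_eqF // ltr_pwDl // mulr_ge0 ?addr_ge0 // ltW.
  have -> : a + c^-1 + b = (1 + (a + b) * c) / c by field.
  have -> : (m.+1%:R * a + m.+1%:R * b) * (c / m.+1%:R) = (a + b) * c.
    by field.
  rewrite /=; move: D0 cN m0; move: (1 + _ * c) (m.+1%:R : R) => D M D0 cN m0; field.
  by rewrite m0 cN D0.
by apply: filterS H => t Ht k kl; exact: Ht.
Qed.

End PathProcess.
End PathGraphWalk.

Lemma cvg_ratio_succ (R : realType) (W : nat -> R) (l : R) :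
  (fun n => W n / n.+1%:R) @ \oo --> l -> (fun n => W n / n%:R) @ \oo --> l.
Proof.
move=> Wl; have H : (fun n : nat => n.+1%:R / n%:R : R) @ \oo --> (1 : R).
  (* The shift discards the index 0, where the denominator vanishes. *)
  rewrite -(cvg_shiftS (fun n => n.+1%:R / n%:R : R)) /=.
  rewrite (_ : (fun n => _) = (fun n => 1 + n.+1%:R^-1)); last first.
    by apply/funext => n; rewrite -natr1 mulrDl divff ?pnatr_eq0 // mul1r.
  have := cvgD (cvg_cst (1 : R)) (@cvg_harmonic R); rewrite addr0; exact.
rewrite -[l]mulr1 (_ : (fun n => _) = (fun n => W n / n.+1%:R * (n.+1%:R / n%:R))).
  exact: cvgM.
by apply/funext => n; rewrite mulrA divfK ?pnatr_eq0.
Qed.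

Theorem theorem1p5 (R : realType) (p q : nat) (hpq : (2 <= minn p q)%N) :
  (exists! ab : R * R,
     [/\ 0 < ab.1 < 1, 0 < ab.2 < 1 & path_system p q ab.1 ab.2]) /\
  (forall alpha beta : R,
     0 < alpha < 1 -> 0 < beta < 1 -> path_system p q alpha beta ->
     forall (d : measure_display) (T : measurableType d)
       (P : probability T R) (X : nat -> T -> seq (edge (path_graph p q))),
       is_ant_process P X ->
       {ae P, forall t,
         (forall k : 'I_p,
            (fun n : nat =>
               ant_weight R (fun m => X m t) n (inl k : path_edge p q) / n%:R)
              @ \oo --> alpha ^+ k.+1) /\
         (forall l : 'I_q,
            (fun n : nat =>
               ant_weight R (fun m => X m t) n (inr l : path_edge p q) / n%:R)
              @ \oo --> beta ^+ l.+1)}).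
Proof.
have /andP[p2 q2] : (2 <= p)%N && (2 <= q)%N by rewrite -leq_min.
split.
  have [alpha [beta [aI bI sys]]] := @path_system_exists R p q p2 q2.
  exists (alpha, beta); split=> // -[a b] /= [aI' bI' sys'].
  by have [-> ->] := path_system_unique p2 q2 aI bI sys aI' bI' sys'.
move=> alpha beta aI bI sys d T P X antX.
have Ha := rate_driven p2 q2 antX true.
have Hb := rate_driven p2 q2 antX false.
apply: filterS2 Ha Hb => t /= da db.
have r01 s := @rate01 R p q p2 q2 _ T X t s.
split=> [k|l]; apply: cvg_ratio_succ.
  have := two_paths_cvg p2 q2 (r01 true) (r01 false) da db aI bI sys (ltn_ord k).
  by rewrite /rate /pedge valKd.
have := two_paths_cvg q2 p2 (r01 false) (r01 true) db da bI aI
  (path_system_sym sys) (ltn_ord l).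
by rewrite /rate /pedge valKd.
Qed.
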